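(* For every natural number $k$ and every real $c>0$ there is a threshold $n_0=n_0(k,c)$ such that the following holds. Let $L$ be a set of $n\geq n_0$ distinct lines in the Euclidean plane $\mathbb{R}^2$ and let $P$ be a set of $n$ distinct points in $\mathbb{R}^2$. If the number of incidences $|\{(p,\ell)\in P\times L : p\in \ell\}|$ is at least $cn^{4/3}$, then there exist $k$ points $p_1,\dots,p_k\in P$ in general position (no three of them collinear) such that for every pair $i\neq j$ there is a line $\ell\in L$ with $p_i\in\ell$ and $p_j\in\ell$.
   Context: An incidence between a point $p$ and a line $\ell$ means $p\in\ell$. A set of points is in general position if no three of its elements are collinear. *)

(* Defs.v *)
From HB Require Import structures.
From mathcomp Require Import all_boot all_order all_algebra finmap.
From mathcomp Require Import boolp classical_sets reals exp.

Set Implicit Arguments.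
Unset Strict Implicit.
Unset Printing Implicit Defensive.

Import Order.TTheory GRing.Theory Num.Theory.
Local Open Scope classical_set_scope.
Local Open Scope fset_scope.
Local Open Scope ring_scope.

Definition is_line (R : realType) (l : set (R * R)) : Prop :=
  exists a b c : R,
    (a, b) <> (0, 0) /\ l = [set p : R * R | a * p.1 + b * p.2 = c]%classic.

Definition collinear3 (R : realType) (p q r : R * R) : Prop :=
  exists2 l : set (R * R), is_line l & [/\ l p, l q & l r].

Definition general_position (R : realType) (S : {fset R * R}) : Prop :=
  forall p q r : R * R, p \in S -> q \in S -> r \in S ->
    p <> q -> p <> r -> q <> r -> ~ collinear3 p q r.

Definition incidences (R : realType) (P : {fset R * R})
    (L : {fset set (R * R)}) : {fset (R * R) * set (R * R)} :=
  [fset x in (P `*` L)%fset | x.1 \in x.2]%fset.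

(* Main.v *)
(** Take a random sample [S] of [r] of order [n^(1/3)] lines and the vertical
    decomposition of its arrangement.  By backwards analysis, on average the lines meet
    [O(n r)] trapezoids in total, and the trapezoid of a given point is met by [O(n / r)]
    lines.  After cutting each trapezoid into groups of [O(n^(1/3))] points, the
    (line, group) pairs with fewer than [2k] incidences carry only a small part of all the
    incidences, so some group of [m] points, [m] of order [n^(1/3)], has at least [c1 m^2]
    incidences on lines containing at least [2k] of its points.

    In such a group discard the lines with more than [eps0 m] points and join two points
    when they lie on a common remaining line.  Each line gives a clique, and these cliques
    are edge-disjoint and cover a positive proportion of all pairs, so after deleting the
    pairs that a regularity partition does not control, [k] points of some line survive
    pairwise.  Their classes are pairwise regular of positive density, and a greedy choice
    in these classes yields a clique that avoids the (short) lines spanned by the points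
    already chosen. *)

Require Import Defs.
From mathcomp Require Import boolp classical_sets reals exp.
From mathcomp Require Import all_boot all_order all_algebra finmap ring lra zify.

Set Implicit Arguments.
Unset Strict Implicit.
Unset Printing Implicit Defensive.

Import Order.TTheory GRing.Theory Num.Theory.
Local Open Scope ring_scope.

(** * Finite sums and partitions *)

Definition cell (X C : finType) (phi : X -> C) (c : C) : {set X} :=
  [set x | phi x == c].

Lemma sum_card_cells (X C : finType) (phi : X -> C) (A : {set X}) :
  (\sum_c #|A :&: cell phi c| = #|A|)%N.
Proof.
rewrite -[RHS]sum1_card (partition_big phi predT) //=; apply: eq_bigr => c _.
by rewrite -sum1_card; apply: eq_bigl => x; rewrite !inE.
Qed.

Lemma sum_in_cells (V : nmodType) (X C : finType) (phi : X -> C)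
    (A : C -> {set X}) (G : X -> V) :
  (forall c, A c \subset cell phi c) ->
  \sum_(x | x \in A (phi x)) G x = \sum_c \sum_(x in A c) G x.
Proof.
move=> subA; rewrite (partition_big phi predT) //=; apply: eq_bigr => c _.
apply: eq_bigl => x; apply/andP/idP => [[xA /eqP <-] //|xA].
by have := subsetP (subA c) x xA; rewrite inE => /eqP ->.
Qed.

Lemma setI_cell_notin (X C : finType) (phi : X -> C) (A : {set X}) (c : C) :
  c \notin phi @: A -> A :&: cell phi c = set0.
Proof.
move=> cNA; apply/setP => x; rewrite !inE; apply/negP => /andP[xA /eqP xc].
by rewrite -xc imset_f in cNA.
Qed.

Definition map_pair (X C : Type) (phi : X -> C) (z : X * X) : C * C := (phi z.1, phi z.2).

Lemma setX_cells (X C : finType) (phi : X -> C) (cd : C * C) :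
  setX (cell phi cd.1) (cell phi cd.2) = cell (map_pair phi) cd.
Proof. by case: cd => c d; apply/setP => -[x y]; rewrite !inE xpair_eqE. Qed.

Lemma sum_card_labels_leq (T I : finType) (L : {set T}) (r : T -> pred I) :
  {in L, forall z i j, r z i -> r z j -> i = j} ->
  (\sum_i #|[set z in L | r z i]| <= #|L|)%N.
Proof.
move=> r_inj; under eq_bigr => i _ do rewrite -sum1_card.
rewrite (exchange_big_dep (mem L)) /=; last by move=> i z _; rewrite inE => /andP[].
rewrite -[leqRHS]sum1_card; apply: leq_sum => z zL; rewrite sum1_card.
apply/card_le1_eqP => i j zi zj; apply: (r_inj z zL).
  by have : z \in [set z in L | r z j] := zj; rewrite inE => /andP[].
by have : z \in [set z in L | r z i] := zi; rewrite inE => /andP[].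
Qed.

(** * A regularity lemma *)

Definition large_subset (R : numDomainType) (X : finType) (eps : R) (A A' : {set X}) : bool :=
  (A' \subset A) && (eps * #|A|%:R <= #|A'|%:R).

Section Regularity.
Variables (R : realFieldType) (X : finType) (g : X * X -> R) (eps eta : R).

Definition uniform (A B : {set X}) (d : R) : bool :=
  [forall A' : {set X}, forall B' : {set X},
    large_subset eps A A' && large_subset eps B B' ==>
    (`|\sum_(z in setX A' B') (g z - d)| <= eta * #|setX A' B'|%:R)].

Definition fit_error (C : finType) (phi : X -> C) (h : C * C -> R) : R :=
  \sum_z (g z - h (map_pair phi z)) ^+ 2.

Definition irregular_area (C : finType) (phi : X -> C) (h : C * C -> R) : R :=
  \sum_(cd | ~~ uniform (cell phi cd.1) (cell phi cd.2) (h cd))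
    #|cell (map_pair phi) cd|%:R.

Lemma fit_error_ge0 C phi h : 0 <= @fit_error C phi h.
Proof. by apply: sumr_ge0 => z _; apply: sqr_ge0. Qed.

Lemma sum_shift_error (D : {set X * X}) (d s : R) :
  \sum_(z in D) ((g z - (d + s)) ^+ 2 - (g z - d) ^+ 2) =
  s ^+ 2 * #|D|%:R - 2 * s * \sum_(z in D) (g z - d).
Proof.
rewrite mulr_natr -sumr_const mulr_sumr -sumrB.
by apply: eq_bigr => z _; ring.
Qed.

Hypotheses (eps_gt0 : 0 < eps) (eta_gt0 : 0 < eta).

Lemma nonuniform_correction (A B : {set X}) (d : R) : ~~ uniform A B d ->
  exists (A' B' : {set X}) (s : R), [/\ A' \subset A, B' \subset B &
    \sum_(z in setX A' B') ((g z - (d + s)) ^+ 2 - (g z - d) ^+ 2)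
      <= - (eta ^+ 2 * eps ^+ 2 * #|setX A B|%:R)].
Proof.
move=> /forallPn[A' /forallPn[B']].
rewrite negb_imply -ltNge => /andP[/andP[/andP[subA large_A] /andP[subB large_B]]].
set dev := \sum_(z in _) _ => dev_gt; exists A', B', (eta * Num.sg dev).
split=> //; rewrite sum_shift_error -/dev exprMn sqr_sg.
have dev_neq0 : dev != 0.
  by rewrite -normr_gt0; apply: le_lt_trans dev_gt; rewrite mulr_ge0 ?ler0n ?ltW.
have dev_abs : 2 * (eta * Num.sg dev) * dev = 2 * (eta * `|dev|).
  by rewrite normrEsg; ring.
rewrite dev_neq0 dev_abs mulr1.
have dev_gain : eta * (eta * #|setX A' B'|%:R) <= eta * `|dev|.
  by rewrite ler_pM2l // ltW.
have large : eps ^+ 2 * #|setX A B|%:R <= #|setX A' B'|%:R :> R.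
  rewrite !cardsX !natrM expr2 mulrACA ler_pM ?mulr_ge0 ?ler0n //; exact: ltW.
have := ler_wpM2l (sqr_ge0 eta) large; lra.
Qed.

Lemma cell_correction (C : finType) (phi : X -> C) (h : C * C -> R) (cd : C * C) :
  exists W : {set X} * {set X} * R,
    [/\ W.1.1 \subset cell phi cd.1, W.1.2 \subset cell phi cd.2 &
    \sum_(z in setX W.1.1 W.1.2) ((g z - (h cd + W.2)) ^+ 2 - (g z - h cd) ^+ 2)
      <= - (if uniform (cell phi cd.1) (cell phi cd.2) (h cd) then 0
            else eta ^+ 2 * eps ^+ 2 * #|cell (map_pair phi) cd|%:R)].
Proof.
rewrite -setX_cells; case: ifPn => [_|/nonuniform_correction[A [B [s [subA subB gain]]]]].
  exists (set0, set0, 0); split; rewrite ?sub0set //= oppr0 big1 // => z.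
  by rewrite !inE.
by exists (A, B, s).
Qed.

(* Shifting the fit by [eta] or [- eta] on a witness rectangle of each irregular pair
   lowers the squared error. *)
Lemma refine_fit (C : finType) (phi : X -> C) (h : C * C -> R) :
  exists (phi' : X -> C * {ffun C -> bool * bool}) h',
    fit_error phi' h'
      <= fit_error phi h - eta ^+ 2 * eps ^+ 2 * irregular_area phi h.
Proof.
have /choice[W W_corr] := cell_correction phi h.
pose rect cd := setX (W cd).1.1 (W cd).1.2.
pose both := map_pair phi.
have sub_rect cd : rect cd \subset cell both cd.
  by have [subA subB _] := W_corr cd; rewrite -setX_cells setXS.
pose phi' x := (phi x,
  [ffun d => (x \in (W (phi x, d)).1.1, x \in (W (d, phi x)).1.2)]).
pose h' (uv : (C * {ffun C -> bool * bool}) * (C * {ffun C -> bool * bool})) :=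
  let cd := (uv.1.1, uv.2.1) in
  if (uv.1.2 cd.2).1 && (uv.2.2 cd.1).2 then h cd + (W cd).2 else h cd.
have h'E z : h' (map_pair phi' z) =
    if z \in rect (both z) then h (both z) + (W (both z)).2 else h (both z).
  by rewrite /h' /= !ffunE /= inE.
exists phi', h'; rewrite -lerBlDl -sumrB (bigID (fun z => z \in rect (both z))) /=.
rewrite [X in _ + X]big1 ?addr0; last by move=> z; rewrite h'E => /negPf ->; rewrite subrr.
under eq_bigr => z zW do rewrite h'E zW.
rewrite (sum_in_cells (fun z => (g z - (h (both z) + (W (both z)).2)) ^+ 2
  - (g z - h (both z)) ^+ 2) sub_rect).
rewrite /irregular_area mulr_sumr [X in - X]big_mkcond -sumrN.
apply: ler_sum => cd _; have [_ _ gain] := W_corr cd; rewrite if_neg.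
apply: le_trans gain; rewrite le_eqVlt; apply/orP; left; apply/eqP.
apply: eq_bigr => z /(subsetP (sub_rect cd)); rewrite inE => /eqP.
by move=> ->.
Qed.

Definition refined_size (c : nat) : nat := (c * 4 ^ c)%N.

Lemma card_refined (C : finType) :
  #|{: C * {ffun C -> bool * bool}}| = refined_size #|C|.
Proof. by rewrite card_prod card_ffun card_prod card_bool. Qed.

Lemma leq_iter_refined_size T c : (c <= iter T refined_size c)%N.
Proof.
elim: T => //= T /leq_trans; apply; rewrite /refined_size.
by rewrite leq_pmulr // expn_gt0.
Qed.

Lemma exists_small_irregular_area (delta : R) T (C : finType) (phi : X -> C) h :
  0 <= delta -> fit_error phi h <= T%:R * (eta ^+ 2 * eps ^+ 2 * delta) ->
  exists (C' : finType) (phi' : X -> C') (h' : C' * C' -> R),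
    (#|C'| <= iter T refined_size #|C|)%N /\ irregular_area phi' h' <= delta.
Proof.
move=> delta_ge0; pose gain := eta ^+ 2 * eps ^+ 2 * delta.
have gain_ge0 : 0 <= gain by rewrite mulr_ge0 // mulr_ge0 // sqr_ge0.
have refine_large (D : finType) (psi : X -> D) k : delta < irregular_area psi k ->
    exists (psi' : X -> D * {ffun D -> bool * bool}) k',
      fit_error psi' k' < fit_error psi k - gain.
  move=> large; have [psi' [k' drop]] := refine_fit psi k; exists psi', k'.
  by apply: le_lt_trans drop _; rewrite ltrD2l ltrN2 ltr_pM2l // mulr_gt0 ?exprn_gt0.
elim: T C phi h => [|T IH] C phi h error_le.
all: have [small|/refine_large[phi' [h' drop]]] := leP (irregular_area phi h) delta;
  first by exists C, phi, h; rewrite leq_iter_refined_size.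
  by have := fit_error_ge0 phi' h'; lra.
have [|C' [phi2 [h2 [card_C' small]]]] := IH _ phi' h'.
  by move: error_le; rewrite -natr1 -/gain; lra.
by exists C', phi2, h2; rewrite iterSr -card_refined.
Qed.

End Regularity.

Lemma regularity (R : archiRealFieldType) (eps eta gamma : R) :
  0 < eps -> 0 < eta -> 0 < gamma ->
  exists M : nat, forall (X : finType) (g : X * X -> R), (forall z, `|g z| <= 1) ->
    exists (C : finType) (phi : X -> C) (h : C * C -> R),
      (#|C| <= M)%N /\ irregular_area g eps eta phi h <= gamma * #|X|%:R ^+ 2.
Proof.
move=> eps_gt0 eta_gt0 gamma_gt0.
have drop_gt0 : 0 < eta ^+ 2 * eps ^+ 2 * gamma by rewrite !mulr_gt0 ?exprn_gt0.
pose T := Num.bound (eta ^+ 2 * eps ^+ 2 * gamma)^-1.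
exists (iter T refined_size 1%N) => X g g_le1; rewrite -[X in iter _ _ X]card_unit.
apply: exists_small_irregular_area (fun=> tt) (fun=> 0) _ _ => //.
  by rewrite mulr_ge0 ?sqr_ge0 // ltW.
apply: (@le_trans _ _ (#|X|%:R ^+ 2)).
  rewrite -natrX -mulnn -card_prod -sum1_card natr_sum; apply: ler_sum => z _.
  by rewrite subr0 -real_normK ?num_real // exprn_ile1.
rewrite [leRHS](_ : _ = T%:R * (eta ^+ 2 * eps ^+ 2 * gamma) * #|X|%:R ^+ 2); last by ring.
rewrite ler_peMl ?sqr_ge0 // -ler_pdivrMr // mul1r ltW // archi_boundP //.
by rewrite invr_ge0 ltW.
Qed.

Definition lower_regular (R : realFieldType) (X : finType) (f : rel X)
    (eps eta : R) (A B : {set X}) : bool :=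
  [forall A' : {set X}, forall B' : {set X},
    large_subset eps A A' && large_subset eps B B' ==>
    (eta * #|setX A' B'|%:R <= #|[set z in setX A' B' | f z.1 z.2]|%:R)].

Section ReducedGraph.
Variables (R : realFieldType) (X : finType) (f : rel X) (eps eta : R).

Definition adjacency (z : X * X) : R := (f z.1 z.2)%:R.

Lemma card_edges (D : {set X * X}) (d : R) :
  #|[set z in D | f z.1 z.2]|%:R = d * #|D|%:R + \sum_(z in D) (adjacency z - d).
Proof.
rewrite sumrB sumr_const -[d *+ _]mulr_natr addrC subrK -natr_sum -sum1_card.
rewrite big_mkcond [X in _ = X%:R]big_mkcond /=; congr (_%:R); apply: eq_bigr => z _.
by rewrite !inE; case: (z \in D); case: (f _ _).
Qed.

Lemma uniform_lower_regular (A B : {set X}) (d : R) :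
  uniform adjacency eps eta A B d -> 2 * eta <= d -> lower_regular f eps eta A B.
Proof.
move=> /forallP unifAB d_ge; apply/forallP => A'; apply/forallP => B'.
have /forallP/(_ B') := unifAB A'; case: (_ && _) => //=.
rewrite ler_norml (card_edges _ d) => /andP[dev_ge _].
have : 2 * eta * #|setX A' B'|%:R <= d * #|setX A' B'|%:R by rewrite ler_wpM2r.
by move: dev_ge; lra.
Qed.

Definition reduced_edge (C : finType) (phi : X -> C) (h : C * C -> R)
    (cd : C * C) : bool :=
  uniform adjacency eps eta (cell phi cd.1) (cell phi cd.2) (h cd)
  && (2 * eta <= h cd).

Lemma card_not_reduced_le (C : finType) (phi : X -> C) (h : C * C -> R) :
  eps <= 1 -> 0 <= eta ->
  #|[set z : X * X | f z.1 z.2 && ~~ reduced_edge phi h (map_pair phi z)]|%:R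
    <= 3 * eta * #|X|%:R ^+ 2 + irregular_area adjacency eps eta phi h.
Proof.
move=> eps_le1 eta_ge0; pose both := map_pair phi.
have areaE : #|X|%:R ^+ 2 = \sum_cd #|cell both cd|%:R :> R.
  rewrite -natrX -mulnn -card_prod -cardsT -(sum_card_cells both) natr_sum.
  by apply: eq_bigr => cd _; rewrite setTI.
rewrite areaE mulr_sumr /irregular_area [X in _ + X]big_mkcond -big_split /=.
rewrite -(sum_card_cells both) natr_sum; apply: ler_sum => cd _ /=.
set bad := _ :&: _; set D := cell both cd in bad *.
have bad_le : (#|bad| <= #|[set z in D | f z.1 z.2]|)%N.
  apply/subset_leq_card/subsetP => z /setIP[z_bad zD]; rewrite inE zD.
  by move: z_bad; rewrite inE => /andP[].
have D_ge0 : 0 <= eta * #|D|%:R by rewrite mulr_ge0.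
case: ifPn => [_|/negPn unif].
  have : #|bad|%:R <= #|D|%:R :> R by rewrite ler_nat subset_leq_card ?subsetIr.
  by lra.
have [h_ge|h_lt] := leP (2 * eta) (h cd).
  suff -> : bad = set0 by rewrite cards0; lra.
  apply/setP => z; rewrite !in_set; apply/negP => /andP[/andP[_ /negP nred] /eqP z_cd].
  by apply: nred; rewrite -/(both z) z_cd /reduced_edge unif.
have dev_le : \sum_(z in D) (adjacency z - h cd) <= eta * #|D|%:R.
  have /forallP/(_ (cell phi cd.1))/forallP/(_ (cell phi cd.2)) := unif.
  by rewrite /large_subset !subxx !ler_piMl //= ler_norml setX_cells => /andP[].
have h_le : h cd * #|D|%:R <= 2 * eta * #|D|%:R by rewrite ler_wpM2r // ltW.
apply: (@le_trans _ _ (#|[set z in D | f z.1 z.2]|%:R)); first by rewrite ler_nat.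
by rewrite (card_edges _ (h cd)); lra.
Qed.

End ReducedGraph.

Lemma card_small_cells_le (R : realFieldType) (X C : finType) (phi : X -> C) (a : R) :
  0 <= a -> #|[set x | #|cell phi (phi x)|%:R < a]|%:R <= #|C|%:R * a.
Proof.
move=> a_ge0; rewrite -(sum_card_cells phi) natr_sum -sum1_card natr_sum mulr_suml.
apply: ler_sum => c _; rewrite mul1r; have [lt_c|ge_c] := ltP #|cell phi c|%:R a.
  by apply: le_trans (ltW lt_c); rewrite ler_nat subset_leq_card ?subsetIr.
rewrite (_ : _ :&: _ = set0) ?cards0 //; apply/setP => x; rewrite !inE.
by apply/negP => /andP[+ /eqP xc]; rewrite xc ltNge ge_c.
Qed.

Lemma regular_reduction (R : archiRealFieldType) (eps eta : R) :
  0 < eps -> eps <= 1 -> 0 < eta ->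
  exists2 mu : R, 0 < mu & forall (X : finType) (f : rel X),
    exists (cl : X -> {set X}) (ok : rel X),
      (forall x y, ok x y -> [/\ lower_regular f eps eta (cl x) (cl y),
         mu * #|X|%:R <= #|cl x|%:R & mu * #|X|%:R <= #|cl y|%:R]) /\
      #|[set z : X * X | f z.1 z.2 && ~~ ok z.1 z.2]|%:R <= 6 * eta * #|X|%:R ^+ 2.
Proof.
move=> eps_gt0 eps_le1 eta_gt0.
have [M partM] := regularity eps_gt0 eta_gt0 eta_gt0.
pose mu : R := eta / M.+1%:R; have mu_gt0 : 0 < mu by rewrite divr_gt0 ?ltr0n.
exists mu => // X f.
have [|C [phi [h [card_C irregular_le]]]] := partM X (adjacency R f).
  by move=> z; rewrite /adjacency; case: (f _ _); rewrite ?normr1 ?normr0 ?ler01.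
pose cl x := cell phi (phi x); pose big x := mu * #|X|%:R <= #|cl x|%:R.
pose red x y := reduced_edge f eps eta phi h (map_pair phi (x, y)).
exists cl, (fun x y => [&& red x y, big x & big y]); split=> [x y|].
  by case/and3P=> /andP[unif h_ge] ? ?; split=> //; apply: uniform_lower_regular h_ge.
pose small := [set x | #|cl x|%:R < mu * #|X|%:R].
have small_le : #|small|%:R <= eta * #|X|%:R.
  apply: le_trans (card_small_cells_le phi _) _; first by rewrite mulr_ge0 // ltW.
  rewrite mulrA ler_wpM2r // /mu mulrCA ler_piMr ?ltW //.
  by rewrite ltr_pdivrMr ?ltr0n // mul1r ltr_nat.
pose unreduced := [set z : X * X | f z.1 z.2 && ~~ red z.1 z.2].
set bad := [set z : X * X | _].
have bad_sub : bad \subset unreduced :|: (setX small setT :|: setX setT small).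
  apply/subsetP => -[x y]; rewrite !inE /= andbT /big !negb_and -!ltNge.
  by case/andP=> -> /or3P[->|->|->]; rewrite ?orbT.
have card_bad : (#|bad| <= #|unreduced| + (#|small| * #|X| + #|X| * #|small|))%N.
  apply: leq_trans (subset_leq_card bad_sub) (leq_trans (leq_card_setU _ _) _).
  by rewrite leq_add2l (leq_trans (leq_card_setU _ _)) // !cardsX cardsT.
move: card_bad; rewrite -(ler_nat R) !natrD !natrM => /le_trans; apply.
have := card_not_reduced_le f phi h eps_le1 (ltW eta_gt0).
have : #|small|%:R * #|X|%:R <= eta * #|X|%:R * #|X|%:R by rewrite ler_wpM2r.
by rewrite -/unreduced; move: irregular_le; lra.
Qed.

(** * Partial linear spaces *)

Section PartialLinearSpace.
Variables (X I : finType) (inc : X -> I -> bool).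

Definition partial_linear : Prop :=
  forall x y i j, x != y -> inc x i -> inc y i -> inc x j -> inc y j -> i = j.

Definition points_on (i : I) : {set X} := [set x | inc x i].

Definition joined (x y : X) : bool := (x != y) && [exists i, inc x i && inc y i].

Definition collinear (x y z : X) : bool := [exists i, [&& inc x i, inc y i & inc z i]].

Definition general_clique (W : seq X) : Prop :=
  [/\ uniq W, {in W &, forall x y, x != y -> joined x y} &
      {in W & &, forall x y z, x != y -> x != z -> y != z -> ~~ collinear x y z}].

Definition rich_incidences (K : nat) (A : {set X}) : nat :=
  \sum_(i | (K <= #|A :&: points_on i|)%N) #|A :&: points_on i|.

Lemma in_points_on x i : (x \in points_on i) = inc x i.
Proof. by rewrite inE. Qed.

Lemma joined_sym : symmetric joined.
Proof.
move=> x y; rewrite /joined eq_sym; congr (_ && _).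
by apply: eq_existsb => i; rewrite andbC.
Qed.

Lemma collinearC x y z : collinear x y z = collinear y x z.
Proof. by apply: eq_existsb => i; rewrite andbCA. Qed.

Lemma collinearAC x y z : collinear x y z = collinear x z y.
Proof. by apply: eq_existsb => i; rewrite [inc y i && _]andbC. Qed.

Lemma general_clique_cons u V :
  general_clique V -> all (joined u) V ->
  {in V &, forall v w, v != w -> ~~ collinear u v w} -> general_clique (u :: V).
Proof.
move=> [V_uniq V_joined V_general] /allP uV u_general; split=> [|v w|x y z].
- by rewrite /= V_uniq andbT; apply/negP => /uV; rewrite /joined eqxx.
- rewrite !inE => /predU1P[->|vV] /predU1P[->|wV]; rewrite ?eqxx //.
  + by move=> _; apply: uV.
  + by move=> _; rewrite joined_sym; apply: uV.
  + exact: V_joined.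
rewrite !inE => /predU1P[->|xV] /predU1P[->|yV] /predU1P[->|zV]; rewrite ?eqxx //.
- by move=> _ _; apply: u_general.
- by move=> _ xz _; rewrite collinearC; apply: u_general.
- by move=> xy _ _; rewrite collinearAC collinearC; apply: u_general.
- exact: V_general.
Qed.

Section Linear.
Hypothesis inc_linear : partial_linear.

Lemma sum_pairs_on_lines_leq (B : {set X * X}) :
  (\sum_i #|[set z in B | [&& z.1 != z.2, inc z.1 i & inc z.2 i]]| <= #|B|)%N.
Proof.
apply: sum_card_labels_leq => z _ i j /and3P[z12 xi yi] /and3P[_ xj yj].
exact: inc_linear z12 xi yi xj yj.
Qed.

Lemma sum_sqr_card_lines_leq (A : {set X}) :
  (\sum_(i | 1 < #|A :&: points_on i|) #|A :&: points_on i| ^ 2 <= 2 * #|A| ^ 2)%N.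
Proof.
pose pairs i := [set z in setX A A | [&& z.1 != z.2, inc z.1 i & inc z.2 i]].
apply: (@leq_trans (2 * \sum_i #|pairs i|)); last first.
  by rewrite leq_mul2l /= (leq_trans (sum_pairs_on_lines_leq _)) // cardsX mulnn.
rewrite big_distrr /= big_mkcond; apply: leq_sum => i _.
case: ifP => // two_points; set t := #|_ :&: _| in two_points *.
have t_sqr : (t ^ 2 <= #|pairs i| + t)%N.
  rewrite -mulnn -cardsX.
  apply: (@leq_trans #|pairs i :|: [set (x, x) | x in A :&: points_on i]|).
    apply/subset_leq_card/subsetP => -[x y]; rewrite !inE /= => /andP[/andP[xA xi] /andP[yA yi]].
    rewrite xA yA xi yi /=; case: eqVneq => [->|_] //=.
    by apply/imsetP; exists y; rewrite ?inE ?yA.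
  by rewrite (leq_trans (leq_card_setU _ _)) // leq_add2l leq_imset_card.
have : (2 * t <= t ^ 2)%N by rewrite -mulnn leq_mul2r two_points orbT.
by move: (t ^ 2)%N #|pairs i| t_sqr => t2 p; lia.
Qed.

Lemma rich_incidences_leq (K : nat) (A : {set X}) :
  (1 < K)%N -> (rich_incidences K A <= 2 * #|A| ^ 2)%N.
Proof.
move=> K_gt1; apply: leq_trans (sum_sqr_card_lines_leq A).
rewrite /rich_incidences big_mkcond [leqRHS]big_mkcond; apply: leq_sum => i _.
case: ifP => // /(leq_trans K_gt1) t_gt1; rewrite t_gt1 -mulnn leq_pmulr //.
exact: ltnW.
Qed.

Lemma exists_line_avoiding (B : {set X * X}) (k : nat) :
  (0 < k)%N -> (2 * #|B| < rich_incidences (2 * k) setT)%N ->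
  exists i : I, (2 * k <= #|points_on i|)%N /\
    (k <= #|[set x in points_on i |
               [forall y in points_on i, (x != y) ==> ((x, y) \notin B)]]|)%N.
Proof.
move=> k_gt0 B_small; pose good i := [set x in points_on i |
  [forall y in points_on i, (x != y) ==> ((x, y) \notin B)]].
have [/existsP[i /andP[rich_i good_i]]|no_line] :=
  boolP [exists i, (2 * k <= #|points_on i|)%N && (k <= #|good i|)%N]; first by exists i.
move: B_small; rewrite ltnNge => /negP[].
apply: leq_trans (leq_mul (leqnn 2) (sum_pairs_on_lines_leq B)).
rewrite /rich_incidences big_distrr /= big_mkcond; apply: leq_sum => i _.
rewrite setTI; case: ifP => // rich_i.
have few_good : (#|good i| < k)%N.
  by move: no_line => /existsPn/(_ i); rewrite rich_i -ltnNge.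
set pairs := [set _ in _ | _].
have bad_pairs : (#|points_on i :\: good i| <= #|pairs|)%N.
  apply: leq_trans (leq_imset_card fst _); apply/subset_leq_card/subsetP => x.
  rewrite !inE => /andP[+ xi]; rewrite xi /= => /forall_inPn[y yi].
  rewrite inE in yi; rewrite negb_imply negbK => /andP[xy xyB].
  by apply/imsetP; exists (x, y); rewrite // !inE /= xyB xy xi yi.
apply: leq_trans (leq_mul (leqnn 2) bad_pairs); have := cardsID (good i) (points_on i).
have := subset_leq_card (subsetIr (points_on i) (good i)).
by move: few_good rich_i; clear; lia.
Qed.

Lemma exists_joined_avoiding (B : {set X * X}) (k : nat) :
  (0 < k)%N -> (2 * #|B| < rich_incidences (2 * k) setT)%N ->
  exists xs : seq X, [/\ uniq xs, size xs = k,
    {in xs &, forall x y, x != y -> joined x y && ((x, y) \notin B)} &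
    {in xs, forall x, exists y, joined x y && ((x, y) \notin B)}].
Proof.
move=> k_gt0 /(exists_line_avoiding k_gt0)[i [rich_i]]; set good := [set x in _ | _].
move=> good_i; exists (take k (enum good)).
have good_pt x : x \in take k (enum good) -> x \in good.
  by move=> /mem_take; rewrite mem_enum.
have good_joined x y : x \in good -> y \in points_on i -> x != y ->
    joined x y && ((x, y) \notin B).
  rewrite inE => /andP[xi /forall_inP good_x] yi xy; move: (good_x y yi).
  rewrite /joined xy /= => ->; rewrite andbT; apply/existsP; exists i.
  by rewrite -!in_points_on xi.
split=> [|||x /good_pt xg]; first by rewrite take_uniq // enum_uniq.
- by rewrite size_takel // -cardE.
- move=> x y /good_pt xg /good_pt; rewrite inE => /andP[yi _].
  exact: good_joined.
have /card_gt0P[y] : (0 < #|points_on i :\ x|)%N.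
  have := cardsD1 x (points_on i); have := xg; rewrite inE => /andP[-> _] card_i.
  by move: rich_i k_gt0; rewrite card_i; clear; lia.
by rewrite in_setD1 eq_sym => /andP[xy yi]; exists y; apply: good_joined.
Qed.

End Linear.

End PartialLinearSpace.

Definition restrict_lines (X I : Type) (p : pred I) (inc : X -> I -> bool) (x : X) (i : I) : bool :=
  p i && inc x i.

Lemma partial_linear_restrict (X I : finType) (p : pred I) (inc : X -> I -> bool) :
  partial_linear inc -> partial_linear (restrict_lines p inc).
Proof.
by move=> lin x y i j xy /andP[_ xi] /andP[_ yi] /andP[_ xj] /andP[_ yj]; apply: lin xj yj.
Qed.

Lemma points_on_restrict (X I : finType) (p : pred I) (inc : X -> I -> bool) i :
  points_on (restrict_lines p inc) i = if p i then points_on inc i else set0.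
Proof. by apply/setP => x; rewrite inE /restrict_lines; case: (p i); rewrite !inE. Qed.

Definition light_line (R : realFieldType) (X I : finType) (inc : X -> I -> bool)
    (beta : R) (i : I) : bool := #|points_on inc i|%:R <= beta.

Lemma rich_incidences_light (R : realFieldType) (X I : finType) (inc : X -> I -> bool)
    (beta : R) (K : nat) :
  partial_linear inc -> (1 < K)%N ->
  beta * (rich_incidences inc K setT)%:R
    <= beta * (rich_incidences (restrict_lines (light_line inc beta) inc) K setT)%:R
       + 2 * #|X|%:R ^+ 2.
Proof.
move=> lin K_gt1; have := sum_sqr_card_lines_leq lin setT.
rewrite cardsT -(ler_nat R) natrM natrX => sqr_le.
apply: le_trans (lerD (lexx _) sqr_le).
rewrite !natr_sum !mulr_sumr big_mkcond [X in _ <= X + _]big_mkcond.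
rewrite [X in _ <= _ + X]big_mkcond -big_split; apply: ler_sum => i _ /=.
rewrite !setTI points_on_restrict; have [light_i|heavy_i] := boolP (light_line inc beta i).
  by case: ifP => // _; rewrite lerDl; case: ifP.
rewrite cards0 leqn0 (gtn_eqF (ltnW K_gt1)) add0r.
case: ifP => [/(leq_trans K_gt1) ->|_]; last by case: ifP.
by rewrite natrX expr2 ler_wpM2r // ltW // ltNge.
Qed.

Lemma general_clique_restrict (X I : finType) (p : pred I) (inc : X -> I -> bool) W :
  partial_linear inc -> general_clique (restrict_lines p inc) W -> general_clique inc W.
Proof.
move=> lin [W_uniq W_joined W_general].
have W_line x y : x \in W -> y \in W -> x != y -> exists i, [&& p i, inc x i & inc y i].
  move=> xW yW /(W_joined _ _ xW yW)/andP[_ /existsP[i /andP[/andP[pi xi] /andP[_ yi]]]].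
  by exists i; rewrite pi xi.
split=> // [x y xW yW xy|x y z xW yW zW xy xz yz].
  have [i /and3P[_ xi yi]] := W_line x y xW yW xy.
  by rewrite /joined xy; apply/existsP; exists i; rewrite xi.
apply/existsPn => i; apply/negP => /and3P[xi yi zi].
have [j /and3P[pj xj yj]] := W_line x y xW yW xy.
have /existsPn/(_ i) := W_general x y z xW yW zW xy xz yz.
by rewrite /restrict_lines xi yi zi (lin x y i j) // pj.
Qed.

(** * General cliques in regular pairs *)

Lemma exists_avoiding (X : finType) (U : {set X}) (Bs : seq {set X}) :
  (\sum_(B <- Bs) #|B| < #|U|)%N ->
  exists2 u, u \in U & {in Bs, forall B : {set X}, u \notin B}.
Proof.
elim: Bs U => [|B Bs IH] U.
  by rewrite big_nil card_gt0 => /set0Pn[u uU]; exists u.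
rewrite big_cons => lt_U; have [|u] := IH (U :\: B).
  rewrite -(ltn_add2l #|B|); apply: leq_trans lt_U _.
  by rewrite -(cardsID B U) leq_add2r subset_leq_card // subsetIr.
rewrite !inE => /andP[uNB uU] uBs; exists u => // B'.
by rewrite inE => /predU1P[->//|/uBs].
Qed.

Lemma ler_sum_seq_const (R : numDomainType) (T : eqType) (s : seq T) (F : T -> R) (c : R) :
  {in s, forall x, F x <= c} -> \sum_(x <- s) F x <= (size s)%:R * c.
Proof.
move=> F_le; rewrite mulr_natl -iter_addr_0 -(count_predT s) -big_const_seq.
by rewrite big_seq [leRHS]big_seq; apply: ler_sum.
Qed.

Lemma card_low_degree_le (R : realFieldType) (X : finType) (f : rel X) (eps eta : R)
    (A B U W : {set X}) :
  0 <= eps -> lower_regular f eps eta A B -> U \subset A -> W \subset B ->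
  eps * #|B|%:R <= #|W|%:R ->
  #|[set u in U | #|[set y in W | f u y]|%:R < eta * #|W|%:R]|%:R
    <= eps * #|A|%:R.
Proof.
move=> eps_ge0 /forallP reg UA WB large_W; set D := [set u in U | _].
have degD u : u \in D -> #|[set y in W | f u y]|%:R < eta * #|W|%:R.
  by rewrite inE => /andP[].
rewrite leNgt; apply/negP => large_D.
have D_large : large_subset eps A D.
  by rewrite /large_subset (ltW large_D) (subset_trans _ UA) //; apply/subsetP => u /[!inE] /andP[].
have /forallP/(_ W) := reg D; rewrite D_large /large_subset WB large_W /=.
have -> : #|[set z in setX D W | f z.1 z.2]| = (\sum_(u in D) #|[set y in W | f u y]|)%N.
  under [RHS]eq_bigr => u _ do rewrite -sum1_card.
  rewrite pair_big_dep -sum1_card; apply: eq_bigl => -[u y].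
  by rewrite !inE /= andbA.
apply/negP; rewrite -ltNge natr_sum.
have -> : eta * #|setX D W|%:R = \sum_(u in D) eta * #|W|%:R.
  by rewrite cardsX natrM mulrCA sumr_const mulr_natl.
have /card_gt0P[u0 u0D] : (0 < #|D|)%N.
  by rewrite -(ltr0n R); apply: le_lt_trans large_D; rewrite mulr_ge0 ?ler0n.
by apply: ltr_sum degD; apply/hasP; exists u0; rewrite ?mem_index_enum.
Qed.

Definition common_joined (X I : finType) (inc : X -> I -> bool) (V : seq X) (A : {set X}) :
  {set X} := [set y in A | all (joined inc y) V].

Section GreedyClique.
Variables (R : realFieldType) (X I : finType) (inc : X -> I -> bool).
Variables (eps eta beta : R) (k : nat).
Hypothesis inc_linear : partial_linear inc.
Hypotheses (eps_ge0 : 0 <= eps) (eta_gt0 : 0 < eta) (eta_le1 : eta <= 1).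
Hypotheses (beta_ge0 : 0 <= beta) (lines_le : forall i, #|points_on inc i|%:R <= beta).

Local Notation common := (common_joined inc).

Definition large_set (B : {set X}) : Prop :=
  k%:R * (eps * #|B|%:R) + (k ^ 2)%:R * beta < eta ^+ k * #|B|%:R.

Lemma card_collinear_le v w : joined inc v w -> #|[set u | collinear inc u v w]|%:R <= beta.
Proof.
move=> /andP[vw /existsP[i /andP[vi wi]]]; apply: le_trans (lines_le i).
rewrite ler_nat; apply/subset_leq_card/subsetP => u; rewrite !inE.
by move=> /existsP[j /and3P[uj vj wj]]; rewrite (inc_linear vw vi wi vj wj).
Qed.

Lemma large_common_joined (V : seq X) (B : {set X}) :
  (0 < k)%N -> (size V <= k)%N -> large_set B ->
  eta ^+ (size V) * #|B|%:R <= #|common V B|%:R -> eps * #|B|%:R <= #|common V B|%:R.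
Proof.
move=> k_gt0 V_le large; apply: le_trans.
apply: (@le_trans _ _ (eta ^+ k * #|B|%:R)); last first.
  by rewrite ler_wpM2r // ler_wiXn2l // ltW.
apply: le_trans (ltW large); rewrite -[leLHS]addr0 lerD ?mulr_ge0 //.
by rewrite ler_peMl ?mulr_ge0 // ler1n.
Qed.

Lemma exists_greedy_vertex (V : seq X) (A : {set X}) (As : seq {set X}) :
  general_clique inc V -> (size V + size (A :: As) = k)%N ->
  {in As, forall B : {set X}, lower_regular (joined inc) eps eta A B} ->
  {in A :: As, forall B : {set X}, large_set B} ->
  {in A :: As, forall B : {set X}, eta ^+ (size V) * #|B|%:R <= #|common V B|%:R} ->
  exists2 u, u \in common V A &
    {in As, forall B : {set X}, eta * #|common V B|%:R <= #|common (u :: V) B|%:R} /\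
    {in V &, forall v w, v != w -> ~~ collinear inc u v w}.
Proof.
move=> [_ V_joined _] size_k reg large cand.
have [k_gt0 V_le As_le] : [/\ (0 < k)%N, (size V <= k)%N & (size As <= k)%N].
  by move: size_k; rewrite /= => <-; split; lia.
pose low B := [set u in common V A |
  #|[set y in common V B | joined inc u y]|%:R < eta * #|common V B|%:R].
pose span v w := if v == w then set0 else [set u | collinear inc u v w].
have [|u uA u_avoids] := @exists_avoiding X (common V A)
    ([seq low B | B <- As] ++ [seq span v w | v <- V, w <- V]).
  rewrite -(ltr_nat R) big_cat natrD /=.
  apply: lt_le_trans (cand A (mem_head _ _)).
  apply: (@lt_le_trans _ _ (eta ^+ k * #|A|%:R)); last first.
    by rewrite ler_wpM2r // ler_wiXn2l // ltW.
  apply: le_lt_trans (large A (mem_head _ _)); rewrite big_map big_allpairs_dep !natr_sum.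
  apply: lerD.
    apply: le_trans (_ : (size As)%:R * (eps * #|A|%:R) <= _); last first.
      by rewrite ler_wpM2r ?mulr_ge0 ?ler_nat.
    apply: ler_sum_seq_const => B BAs; have BAAs : B \in A :: As by rewrite inE BAs orbT.
    apply: (card_low_degree_le eps_ge0 (reg B BAs)); rewrite ?subsetIl //.
    - by apply/subsetP => y; rewrite inE => /andP[].
    - by apply/subsetP => y; rewrite inE => /andP[].
    - exact: large_common_joined (large B BAAs) (cand B BAAs).
  have span_le v w : v \in V -> w \in V -> #|span v w|%:R <= beta.
    rewrite /span; case: eqVneq => [_ _ _|vw vV wV]; first by rewrite cards0.
    exact: card_collinear_le (V_joined v w vV wV vw).
  apply: (@le_trans _ _ ((size V)%:R * ((size V)%:R * beta))); last first.
    by rewrite mulrA -natrM -mulnn ler_wpM2r // ler_nat leq_mul.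
  apply: ler_sum_seq_const => v vV; rewrite natr_sum; apply: ler_sum_seq_const => w wV.
  exact: span_le.
exists u => //; split=> [B BAs|v w vV wV vw].
  have : u \notin low B by apply: u_avoids; rewrite mem_cat map_f.
  rewrite inE uA -leNgt /= => /le_trans; apply; rewrite ler_nat.
  apply/subset_leq_card/subsetP => y; rewrite !inE /= => /andP[/andP[-> ->]].
  by rewrite joined_sym => ->.
have : u \notin span v w by apply: u_avoids; rewrite mem_cat allpairs_f ?orbT.
by rewrite /span (negPf vw) inE.
Qed.

Lemma extend_general_clique (As : seq {set X}) (V : seq X) :
  general_clique inc V -> (size V + size As = k)%N ->
  pairwise (lower_regular (joined inc) eps eta) As ->
  {in As, forall B : {set X}, large_set B} ->
  {in As, forall B : {set X}, eta ^+ (size V) * #|B|%:R <= #|common V B|%:R} ->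
  exists2 W, size W = k & general_clique inc W.
Proof.
elim: As V => [|A As IH] V V_clique size_k; first by exists V => //; rewrite -size_k addn0.
rewrite pairwise_cons => /andP[/allP regA reg] large cand.
have [u uA [u_cand u_general]] := exists_greedy_vertex V_clique size_k regA large cand.
apply: (IH (u :: V)) => //=.
- apply: general_clique_cons => //.
  by move: uA; rewrite inE => /andP[].
- by rewrite -size_k addnS.
- by move=> B BAs; apply: large; rewrite inE BAs orbT.
- move=> B BAs; apply: le_trans (u_cand B BAs).
  by rewrite exprS -mulrA ler_pM2l // cand // inE BAs orbT.
Qed.

End GreedyClique.

Lemma exists_greedy_constants (R : realFieldType) (k : nat) (c : R) : (0 < k)%N -> 0 < c ->
  exists eta eps : R, [/\ 0 < eta <= 1, 12 * eta < c, 0 < eps <= 1 &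
    k%:R * eps = eta ^+ k / 2].
Proof.
move=> k_gt0 c_gt0; have k0 : 0 < k%:R :> R by rewrite ltr0n.
pose eta : R := Num.min c 1 / 24; pose eps := eta ^+ k / (2 * k%:R).
have min_gt0 : 0 < Num.min c 1 by rewrite lt_min c_gt0 ltr01.
have min_le_c : Num.min c 1 <= c by rewrite ge_min lexx.
have min_le1 : Num.min c 1 <= 1 by rewrite ge_min lexx orbT.
have [eta_gt0 eta_le1] : 0 < eta /\ eta <= 1 by rewrite /eta; split; lra.
have k_eps : k%:R * eps = eta ^+ k / 2 by rewrite /eps; field; rewrite gt_eqF.
have eps_gt0 : 0 < eps by rewrite divr_gt0 ?exprn_gt0 // mulr_gt0.
exists eta, eps; split=> //; rewrite ?eta_gt0 ?eps_gt0 //=; first by rewrite /eta; lra.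
have : eps <= k%:R * eps by apply: ler_peMl; rewrite ?ler1n // ltW.
have : eta ^+ k <= 1 by rewrite exprn_ile1 // ltW.
by rewrite k_eps; lra.
Qed.

Lemma light_space_general_clique (R : archiRealFieldType) (k : nat) (c : R) :
  (0 < k)%N -> 0 < c ->
  exists2 eps0 : R, 0 < eps0 & forall (X I : finType) (inc : X -> I -> bool),
    partial_linear inc -> (0 < #|X|)%N ->
    (forall i, #|points_on inc i|%:R <= eps0 * #|X|%:R) ->
    c * #|X|%:R ^+ 2 <= (rich_incidences inc (2 * k) setT)%:R ->
    exists2 W, size W = k & general_clique inc W.
Proof.
move=> k_gt0 c_gt0.
have [eta [eps [/andP[eta_gt0 eta_le1] eta_c /andP[eps_gt0 eps_le1] k_eps]]] :=
  exists_greedy_constants k_gt0 c_gt0.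
have [mu mu_gt0 reduce] := regular_reduction eps_gt0 eps_le1 eta_gt0.
have etak_gt0 : 0 < eta ^+ k by rewrite exprn_gt0.
have k2_gt0 : 0 < (k ^ 2)%:R :> R by rewrite ltr0n expn_gt0 k_gt0.
pose eps0 : R := mu * eta ^+ k / (4 * (k ^ 2)%:R).
have k2_eps0 : (k ^ 2)%:R * eps0 = mu * eta ^+ k / 4.
  by rewrite /eps0; field; rewrite pnatr_eq0 -lt0n.
have eps0_gt0 : 0 < eps0 by rewrite divr_gt0 // mulr_gt0.
exists eps0 => // X I inc inc_linear X_gt0 lines_le rich.
have m_gt0 : 0 < #|X|%:R :> R by rewrite ltr0n.
have [cl [ok [okP bad_le]]] := reduce X (joined inc).
have [|xs [xs_uniq size_xs xs_joined xs_pair]] := exists_joined_avoiding inc_linear k_gt0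
    (B := [set z | joined inc z.1 z.2 && ~~ ok z.1 z.2]).
  rewrite -(ltr_nat R) natrM; apply: lt_le_trans rich.
  have : 12 * eta * #|X|%:R ^+ 2 < c * #|X|%:R ^+ 2 by rewrite ltr_pM2r // exprn_gt0.
  by move: bad_le; lra.
have okI x y : joined inc x y && ((x, y) \notin
    [set z | joined inc z.1 z.2 && ~~ ok z.1 z.2]) -> ok x y.
  by rewrite inE /= => /andP[->]; rewrite negbK.
apply: (@extend_general_clique R X I inc eps eta (eps0 * #|X|%:R) k
  inc_linear (ltW eps_gt0) eta_gt0 eta_le1 _ lines_le [seq cl x | x <- xs] [::]).
- by rewrite mulr_ge0 // ltW.
- by split.
- by rewrite size_map.
- rewrite pairwise_map; move: xs_uniq; rewrite uniq_pairwise.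
  apply: sub_in_pairwise (allss xs) => x y xxs yxs xy.
  by have [] := okP x y (okI x y (xs_joined x y xxs yxs xy)).
- move=> _ /mapP[x xxs ->]; have [y /okI/okP[_ cl_large _]] := xs_pair x xxs.
  have cl_gt0 : 0 < #|cl x|%:R :> R by apply: lt_le_trans cl_large; rewrite mulr_gt0.
  have := ler_wpM2l (ltW etak_gt0) cl_large; have := mulr_gt0 etak_gt0 cl_gt0.
  by rewrite /large_set [k%:R * _]mulrA k_eps [(k ^ 2)%:R * _]mulrA k2_eps0; lra.
- move=> _ /mapP[x _ ->]; rewrite expr0 mul1r ler_nat subset_leq_card //.
  by apply/subsetP => y; rewrite inE andbT.
Qed.

Lemma dense_space_general_clique (R : archiRealFieldType) (k : nat) (c : R) :
  (0 < k)%N -> 0 < c ->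
  exists m0 : nat, forall (X I : finType) (inc : X -> I -> bool),
    partial_linear inc -> (m0 <= #|X|)%N ->
    c * #|X|%:R ^+ 2 <= (rich_incidences inc (2 * k) setT)%:R ->
    exists2 W, size W = k & general_clique inc W.
Proof.
move=> k_gt0 c_gt0; have c2_gt0 : 0 < c / 2 by rewrite divr_gt0.
have [eps0 eps0_gt0 light_clique] := light_space_general_clique k_gt0 c2_gt0.
pose m0 := Num.bound (4 / (eps0 * c)).
have m0_large : 4 / (eps0 * c) < m0%:R by rewrite archi_boundP // divr_ge0 // mulr_ge0 // ltW.
exists m0.+1 => X I inc inc_linear X_large rich.
set m : R := #|X|%:R in rich; have m_gt0 : 0 < m by rewrite ltr0n; apply: leq_trans X_large.
have m_large : 4 <= eps0 * c * m.
  rewrite [leRHS]mulrC -ler_pdivrMr ?mulr_gt0 //; apply: le_trans (ltW m0_large) _.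
  by rewrite ler_nat ltnW.
have beta_gt0 : 0 < eps0 * m by rewrite mulr_gt0.
have K_gt1 : (1 < 2 * k)%N by rewrite (leq_trans _ (leq_pmulr 2 k_gt0)).
have rich_split := rich_incidences_light (eps0 * m) inc_linear K_gt1.
set light := light_line inc (eps0 * m) in rich_split.
set inc_light := restrict_lines light inc in rich_split.
have rich_light : c / 2 * m ^+ 2 <= (rich_incidences inc_light (2 * k) setT)%:R.
  rewrite -(ler_pM2l beta_gt0).
  have : 4 * (m ^+ 2 / 2) <= eps0 * c * m * (m ^+ 2 / 2).
    by rewrite ler_wpM2r // divr_ge0 ?sqr_ge0.
  have := ler_wpM2l (ltW beta_gt0) rich.
  by move: rich_split; rewrite -/m; lra.
have [||W size_W W_clique] := light_clique X I _
    (partial_linear_restrict (p := light) inc_linear) _ _ rich_light.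
- exact: leq_trans X_large.
- move=> i; rewrite points_on_restrict; case: ifP => [//|_].
  by rewrite cards0 ltW.
by exists W => //; apply: general_clique_restrict W_clique.
Qed.

Lemma general_clique_map (Y X I : finType) (f : Y -> X) (inc : X -> I -> bool) (W : seq Y) :
  injective f -> general_clique (fun y i => inc (f y) i) W ->
  general_clique inc (map f W).
Proof.
move=> f_inj [W_uniq W_joined W_general]; split.
- by rewrite map_inj_uniq.
- move=> _ _ /mapP[x xW ->] /mapP[y yW ->]; rewrite /joined (inj_eq f_inj) => xy.
  by have := W_joined x y xW yW xy; rewrite /joined xy.
- move=> _ _ _ /mapP[x xW ->] /mapP[y yW ->] /mapP[z zW ->]; rewrite !(inj_eq f_inj).
  exact: W_general.
Qed.

Lemma rich_incidences_imset (Y X I : finType) (f : Y -> X) (inc : X -> I -> bool) (K : nat) :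
  injective f ->
  rich_incidences (fun y i => inc (f y) i) K setT = rich_incidences inc K (f @: setT).
Proof.
move=> f_inj; have card_line i : #|setT :&: points_on (fun y i => inc (f y) i) i|
    = #|f @: setT :&: points_on inc i|.
  rewrite setTI -(card_imset _ f_inj); apply: eq_card => x; rewrite in_setI inE.
  apply/imsetP/andP => [[y yi ->]|[/imsetP[y _ ->] yi]]; last by exists y; rewrite ?inE.
  by rewrite imset_f //; move: yi; rewrite inE.
by rewrite /rich_incidences; apply: eq_big => i; rewrite card_line.
Qed.

Lemma dense_subset_general_clique (R : archiRealFieldType) (k : nat) (c : R) :
  (0 < k)%N -> 0 < c ->
  exists m0 : nat, forall (X I : finType) (inc : X -> I -> bool) (A : {set X}),
    partial_linear inc -> (m0 <= #|A|)%N ->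
    c * #|A|%:R ^+ 2 <= (rich_incidences inc (2 * k) A)%:R ->
    exists2 W, size W = k & general_clique inc W.
Proof.
move=> k_gt0 c_gt0; have [m0 dense_clique] := dense_space_general_clique k_gt0 c_gt0.
exists m0 => X I inc A inc_linear A_large.
pose Y := {x : X | x \in A}.
have AE : [set val y | y in [set: Y]] = A.
  apply/setP => x; apply/imsetP/idP => [[y _ ->]|xA]; first exact: valP.
  by exists (exist _ x xA).
have card_Y : #|{: Y}| = #|A| by rewrite -[in RHS]AE card_imset ?cardsT //; exact: val_inj.
rewrite -{2}AE -(rich_incidences_imset _ _ val_inj) -card_Y => rich.
have [||W size_W W_clique] := dense_clique Y I _ _ _ rich.
- by move=> x y i j xy; apply: inc_linear; rewrite (inj_eq val_inj).
- by rewrite card_Y.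
exists (map val W); first by rewrite size_map.
by apply: general_clique_map W_clique; exact: val_inj.
Qed.

(** * Vertical decomposition of an arrangement of lines *)

Lemma leq_card_cover_le1 (T K : finType) (A : {set T}) (B : K -> {set T}) :
  {in A, forall x, exists z, x \in B z} -> (forall z, (#|B z| <= 1)%N) -> (#|A| <= #|K|)%N.
Proof.
move=> AB B_le1; apply: leq_trans (_ : #|\bigcup_(z in K) B z| <= _)%N.
  by apply/subset_leq_card/subsetP => x /AB[z xz]; apply/bigcupP; exists z.
rewrite -[leqRHS]sum1_card; elim/big_rec2: _ => [|z n D _ D_le]; first by rewrite cards0.
by rewrite (leq_trans (leq_card_setU _ _)) // addnC [leqRHS]addnC leq_add.
Qed.

Lemma leq_card_coded (T U V : finType) (Q : {set T}) (lab : T -> U) (E : {set V})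
    (codes : T -> V -> bool) :
  {in Q, forall q, exists2 z, z \in E & codes q z} ->
  {in Q &, forall q q' z, codes q z -> codes q' z -> lab q = lab q'} ->
  (#|lab @: Q| <= #|E|)%N.
Proof.
move=> has_code code_inj; have /choice[code codeP] :
    forall u : U, exists z : option V, u \in lab @: Q ->
      exists2 v, z = Some v /\ v \in E & exists2 q, q \in Q & codes q v /\ lab q = u.
  move=> u; have [/imsetP[q qQ ->]|_] := boolP (u \in lab @: Q); last by exists None.
  by have [v vE qv] := has_code q qQ; exists (Some v) => _; exists v => //; exists q.
rewrite -(card_in_imset (f := code)); last first.
  move=> u u' /codeP[v [-> _] [q qQ [qv <-]]] /codeP[v' [-> _] [q' q'Q [q'v' <-]]] [vv'].
  by apply: code_inj qv _ => //; rewrite vv'.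
rewrite -(card_imset (mem E) Some_inj).
apply/subset_leq_card/subsetP => _ /imsetP[u /codeP[v [-> vE] _] ->].
exact: imset_f.
Qed.

Section AffineSigns.
Variable R : realFieldType.
Implicit Types a b x : R.

Lemma affine_lt0_beyond a b x0 x1 x2 :
  0 <= a * x0 + b -> a * x1 + b < 0 -> 0 <= (x1 - x0) * (x2 - x1) -> a * x2 + b < 0.
Proof.
move=> ge0 lt0 x1_between; rewrite ltNge; apply/negP => ge0'.
have down : a * (x1 - x0) < 0 by lra.
have up : 0 < a * (x2 - x1) by lra.
have : 0 < - (a * (x1 - x0)) * (a * (x2 - x1)) by rewrite mulr_gt0 // oppr_gt0.
have -> : - (a * (x1 - x0)) * (a * (x2 - x1)) = - (a ^+ 2 * ((x1 - x0) * (x2 - x1))) by ring.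
by rewrite oppr_gt0 ltNge mulr_ge0 // sqr_ge0.
Qed.

Lemma no_mutual_crossing a1 b1 a2 b2 x0 x1 x2 :
  0 <= a1 * x0 + b1 -> 0 <= a2 * x0 + b2 ->
  a1 * x1 + b1 < 0 -> a2 * x2 + b2 < 0 ->
  0 <= a2 * x1 + b2 -> 0 <= a1 * x2 + b1 ->
  (x0 < x1) = (x0 < x2) -> False.
Proof.
move=> ge10 ge20 lt11 lt22 ge21 ge12 same_side.
have [between1|between2] : 0 <= (x1 - x0) * (x2 - x1) \/ 0 <= (x2 - x0) * (x1 - x2).
- move: same_side; have [x12|/ltW x21] := leP x1 x2; case: (ltP x0 x1) => [/ltW|] x01 /esym.
  + by left; rewrite mulr_ge0 // subr_ge0.
  + by move=> /negbT; rewrite -leNgt => x20; right; rewrite mulr_le0 // subr_le0.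
  + by move=> /ltW x02; right; rewrite mulr_ge0 // subr_ge0.
  + by left; rewrite mulr_le0 // subr_le0.
- by have := affine_lt0_beyond ge10 lt11 between1; rewrite ltNge ge12.
- by have := affine_lt0_beyond ge20 lt22 between2; rewrite ltNge ge21.
Qed.

End AffineSigns.

Section VerticalDecomposition.
Variables (R : realFieldType) (X I : finType).
Variables (px py : X -> R) (slope icept : I -> R).
Implicit Types (S : {set I}) (p q : X) (i l t u v : I) (s rightward : bool).

Definition height (i : I) (x : R) : R := slope i * x + icept i.

Definition on_line (p : X) (i : I) : bool := py p == height i (px p).

Definition vertically_generic : Prop :=
  forall p i j, i != j -> height i (px p) = height j (px p) -> on_line p i.

(* The directions [s = false] and [s = true] are upwards and downwards. *)
Definition gap (s : bool) (i : I) (p : X) : R := (-1) ^+ s * (height i (px p) - py p).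

Definition side (s : bool) (S : {set I}) (p : X) : {set I} :=
  [set i in S | 0 < gap s i p].

Definition nearest (s : bool) (S : {set I}) (p : X) : {set I} :=
  [set t in side s S p | [forall u in side s S p, gap s t p <= gap s u p]].

Definition through (S : {set I}) (p : X) : {set I} := [set i in S | on_line p i].

(* When no line of [S] passes through [p], this identifies the trapezoid of the
   vertical decomposition of [S] that contains [p]: as the faces of the arrangement
   are convex, a face together with the two lines bounding it above and below [p]
   determines the trapezoid. *)
Definition trapezoid (S : {set I}) (p : X) : {ffun bool -> {set I} * {set I}} :=
  [ffun s => (side s S p, nearest s S p)].

Definition free_points (S : {set I}) (l : I) : {set X} :=
  [set q | on_line q l && (through S q == set0)].

Definition met_trapezoids (S : {set I}) (l : I) : {set {ffun bool -> {set I} * {set I}}} :=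
  [set trapezoid S q | q in free_points S l].

Lemma gapN s i p : gap (~~ s) i p = - gap s i p.
Proof. by rewrite /gap; case: s; rewrite /= ?expr0 ?expr1 mulN1r ?opprK mul1r ?opprK. Qed.

Lemma gap_eq0 s i p : (gap s i p == 0) = on_line p i.
Proof. by rewrite /gap mulf_eq0 signr_eq0 /= subr_eq0 eq_sym. Qed.

Lemma gapB s i t p : gap s i p - gap s t p =
  (-1) ^+ s * (slope i - slope t) * px p + (-1) ^+ s * (icept i - icept t).
Proof. by rewrite /gap /height; ring. Qed.

Lemma gap_ltE s v u p : (gap s v p < gap s u p) =
  if s then height u (px p) < height v (px p) else height v (px p) < height u (px p).
Proof. by rewrite -subr_gt0 /gap; case: s; rewrite /= ?expr0 ?expr1; apply/idP/idP; lra. Qed.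

Lemma through_sides S p : through S p = S :\: (side false S p :|: side true S p).
Proof.
apply/setP => i; rewrite !inE -(gap_eq0 false) (gapN false) oppr_gt0.
by case: (i \in S); rewrite /= ?andbF ?andbT //; case: ltgtP.
Qed.

Lemma eq_trapezoid_side S S' p q s : trapezoid S p = trapezoid S' q -> side s S p = side s S' q.
Proof. by move=> /ffunP/(_ s); rewrite !ffunE => -[]. Qed.

Lemma eq_trapezoid_nearest S S' p q s :
  trapezoid S p = trapezoid S' q -> nearest s S p = nearest s S' q.
Proof. by move=> /ffunP/(_ s); rewrite !ffunE => -[]. Qed.

Lemma eq_trapezoid_through S p q : trapezoid S p = trapezoid S q -> through S p = through S q.
Proof. by move=> eq_pq; rewrite !through_sides !(eq_trapezoid_side _ eq_pq). Qed.

Lemma exists_nearest s S p i : i \in side s S p -> exists t, t \in nearest s S p.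
Proof.
move=> i_side; case: (arg_minP (fun i => gap s i p) i_side) => t t_side t_min.
by exists t; rewrite inE (t_side : t \in side s S p); apply/forall_inP.
Qed.

Lemma nearestP s S p t : reflect
  [/\ t \in S, 0 < gap s t p & {in side s S p, forall u, gap s t p <= gap s u p}]
  (t \in nearest s S p).
Proof.
rewrite !inE; apply: (iffP andP) => [[/andP[? ?] /forall_inP]|[-> -> t_min]] //.
by split=> //; apply/forall_inP.
Qed.

Lemma nearest_side s S p t : t \in nearest s S p -> t \in side s S p.
Proof. by rewrite inE => /andP[]. Qed.

Lemma nearestD1 s S p t l : t \in nearest s S p -> t != l -> t \in nearest s (S :\ l) p.
Proof.
move=> /nearestP[tS t_gt0 t_min] tl; apply/nearestP; rewrite !inE tl tS; split=> // u.
by rewrite !inE -andbA => /and3P[_ uS u_gt0]; apply: t_min; rewrite inE uS.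
Qed.

Section GenericArrangement.
Hypothesis generic : vertically_generic.

Lemma generic_gap_eq s i j p : gap s i p = gap s j p -> i != j -> on_line p i.
Proof.
move=> eq_gap ij; apply: (generic ij); move: eq_gap => /(mulfI _)/addIr -> //.
by rewrite signr_eq0.
Qed.

Lemma card_nearest_le1 s S p : (#|nearest s S p| <= 1)%N.
Proof.
apply/card_le1_eqP => i j i_near j_near.
have /nearestP[_ i_gt0 i_min] := i_near; have /nearestP[_ _ j_min] := j_near.
apply/eqP/negPn/negP => ji; have eq_gap : gap s i p = gap s j p.
  by apply/eqP; rewrite eq_le i_min ?j_min ?nearest_side.
have := generic_gap_eq eq_gap; rewrite eq_sym => /(_ ji).
by rewrite -(gap_eq0 s) gt_eqF.
Qed.

Definition blocking (s rightward : bool) (S : {set I}) (p : X) : {set I} :=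
  [set l in side s S p :\: nearest s S p | [exists q, [&& on_line q l,
     (px p < px q) == rightward & trapezoid (S :\ l) q == trapezoid (S :\ l) p]]].

Lemma blocking_crossing s rightward S p t l :
  t \in nearest s S p -> l \in blocking s rightward S p ->
  exists q, [/\ (px p < px q) = rightward, gap s t p <= gap s l p, gap s l q < gap s t q &
    {in blocking s rightward S p, forall l', l' != l -> gap s t q <= gap s l' q}].
Proof.
move=> t_near; rewrite inE in_setD => /andP[/andP[l_far l_side]].
move=> /existsP[q /and3P[ql /eqP right_q /eqP eq_q]]; exists q.
have tl : t != l by apply: contraNneq l_far => <-.
have := nearestD1 t_near tl; rewrite -(eq_trapezoid_nearest s eq_q).
have /nearestP[_ _ t_min] := t_near; move=> /nearestP[_ t_gt0 t_min_q].
split=> // [||l' l'_block l'l]; first exact: t_min.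
  by move: ql; rewrite -(gap_eq0 s) => /eqP ->.
apply: t_min_q; rewrite (eq_trapezoid_side s eq_q).
by move: l'_block; rewrite !inE l'l => /andP[/andP[_ ->]].
Qed.

(* Two such lines would each have to cross the nearest line before the other does. *)
Lemma card_blocking_le1 s rightward S p : (#|blocking s rightward S p| <= 1)%N.
Proof.
apply/card_le1_eqP => l1 l2 l1_block l2_block; apply/eqP/negPn/negP => l21.
have [t t_near] : exists t, t \in nearest s S p.
  by apply: (@exists_nearest s S p l1); move: l1_block; rewrite !inE => /andP[/andP[_ ->]].
have [q1 [right1 t_le1 l1_lt t_min1]] := blocking_crossing t_near l1_block.
have [q2 [right2 t_le2 l2_lt t_min2]] := blocking_crossing t_near l2_block.
pose a l := (-1) ^+ s * (slope l - slope t); pose b l := (-1) ^+ s * (icept l - icept t).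
have le_gapE l q : (gap s t q <= gap s l q) = (0 <= a l * px q + b l).
  by rewrite -subr_ge0 gapB.
have lt_gapE l q : (gap s l q < gap s t q) = (a l * px q + b l < 0).
  by rewrite -subr_lt0 gapB.
apply: (@no_mutual_crossing _ (a l1) (b l1) (a l2) (b l2) (px p) (px q1) (px q2));
  rewrite -?le_gapE -?lt_gapE ?right1 ?right2 //.
- exact: t_min1.
- by apply: t_min2 l1_block _; rewrite eq_sym.
Qed.

Lemma card_lines_meeting_trapezoid_le7 S p :
  (#|[set l in S | trapezoid (S :\ l) p \in met_trapezoids (S :\ l) l]| <= 7)%N.
Proof.
pose alone := [set l in S | on_line p l && (through (S :\ l) p == set0)].
pose cover (z : option (bool * option bool)) := match z with
  | None => alone
  | Some (s, None) => nearest s S p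
  | Some (s, Some rightward) => blocking s rightward S p
  end.
have -> : 7%N = #|{: option (bool * option bool)}|.
  by rewrite card_option card_prod card_option !card_bool.
apply: (@leq_card_cover_le1 _ _ _ cover) => [l|[[s [rightward|]]|]] /=; last first.
- apply/card_le1_eqP => l1 l2; rewrite !inE => /and3P[l1S pl1 /eqP/setP/(_ l2)].
  by rewrite !inE => + /and3P[l2S pl2 _]; rewrite l2S pl2 !andbT => /negbFE/eqP.
- exact: card_nearest_le1.
- exact: card_blocking_le1.
rewrite inE => /andP[lS /imsetP[q /[!inE] /andP[ql free_q] eq_pq]].
have [pl|p_off] := boolP (on_line p l).
  by exists None; rewrite inE lS pl (eq_trapezoid_through eq_pq).
have [s l_side] : exists s, l \in side s S p.
  move: p_off; rewrite -(gap_eq0 false) neq_lt => /orP[lt0|gt0].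
    by exists true; rewrite inE lS (gapN false) oppr_gt0.
  by exists false; rewrite inE lS.
have [l_near|l_far] := boolP (l \in nearest s S p); first by exists (Some (s, None)).
exists (Some (s, Some (px p < px q))); rewrite inE in_setD l_far l_side.
by apply/existsP; exists q; rewrite ql eqxx eq_pq eqxx.
Qed.

Definition crossing (u v : I) : R := (icept u - icept v) / (slope v - slope u).

Lemma crossingC u v : crossing u v = crossing v u.
Proof. by rewrite /crossing -[icept u - _]opprB -[slope v - _]opprB invrN mulrNN. Qed.

Lemma height_lt_before_crossing u v x x' : height u x < height v x -> x <= x' ->
  (slope u != slope v -> x < crossing u v -> x' < crossing u v) ->
  height u x' < height v x'.
Proof.
move=> lt_uv xx' no_crossing; have [slope_uv|slope_uv] := eqVneq (slope u) (slope v).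
  by move: lt_uv; rewrite /height slope_uv; lra.
have [le_slope|lt_slope] := leP (slope u) (slope v).
  have := ler_wpM2r (_ : 0 <= x' - x) le_slope; rewrite subr_ge0 => /(_ xx').
  by move: lt_uv; rewrite /height !mulrBr; lra.
have before y : (y < crossing u v) = (height u y < height v y).
  rewrite crossingC /crossing ltr_pdivlMr ?subr_gt0 // /height.
  by apply/idP/idP; lra.
by rewrite -before; apply: no_crossing; rewrite ?before.
Qed.

(* The three lines bounding the two parts of a trapezoid cut by a line of [S]:
   the cutting line itself and the two nearest lines. *)
Definition role (S : {set I}) (j : option bool) (q : X) : {set I} :=
  if j is Some s then nearest s S q else through S q.

Lemma role_sub S j q v : v \in role S j q -> v \in S.
Proof. by case: j => [s /nearestP[]|] //; rewrite inE => /andP[]. Qed.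

Lemma gap_neq S q s u v : #|through S q| = 1%N -> u \in S -> v \in S -> u != v ->
  gap s u q != gap s v q.
Proof.
move=> q1 uS vS uv; apply/eqP => eq_gap.
have ut : u \in through S q by rewrite inE uS (generic_gap_eq eq_gap).
have vt : v \in through S q by rewrite inE vS (generic_gap_eq (esym eq_gap)) // eq_sym.
have /card_le1_eqP/(_ u v ut vt) : (#|through S q| <= 1)%N by rewrite q1.
by move=> vu; rewrite vu eqxx in uv.
Qed.

Section SameTrapezoid.
Variables (S : {set I}) (q q' : X).
Hypotheses (q_cut : #|through S q| = 1%N) (q'_cut : #|through S q'| = 1%N).
Hypothesis same_order : forall j v u s, v \in role S j q -> u \in S ->
  (gap s v q < gap s u q) = (gap s v q' < gap s u q').

Lemma same_order_below j v u s : v \in role S j q -> u \in S ->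
  (gap s u q < gap s v q) = (gap s u q' < gap s v q').
Proof.
move=> v_role uS; rewrite -[LHS]ltrN2 -[RHS]ltrN2 -!gapN.
exact: same_order v_role uS.
Qed.

Lemma same_through j v : v \in role S j q -> v \in role S j q' -> through S q = through S q'.
Proof.
have /eqP/cards1P[l thr_q] := q_cut; have /eqP/cards1P[l' thr_q'] := q'_cut.
have l_role : l \in role S None q by rewrite /= thr_q set11.
have lS := role_sub l_role.
have l'S : l' \in S by apply: (@role_sub S None q'); rewrite /= thr_q' set11.
have gap_l s : gap s l q = 0 by apply/eqP; rewrite gap_eq0; move: l_role; rewrite inE lS.
have gap_l' s : gap s l' q' = 0.
  by apply/eqP; rewrite gap_eq0; move: (set11 l'); rewrite -thr_q' inE l'S.
case: j => [s|] /= v_role; last first.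
  by move: v_role; rewrite thr_q thr_q' !inE => /eqP -> /eqP ->.
move=> /nearestP[vS v_gt0' v_min']; have /nearestP[_ v_gt0 v_min] := v_role.
rewrite thr_q thr_q'; congr [set _]; apply/eqP/negPn/negP => ll'.
have l'_inner : gap s l' q < gap s v q.
  by rewrite (same_order_below s (j := Some s) v_role) // gap_l'.
have l'_beyond : gap s l' q < gap s l q.
  have l'l : l' != l by rewrite eq_sym.
  rewrite lt_neqAle (gap_neq s q_cut) //= gap_l leNgt; apply: contraTN l'_inner => l'_gt0.
  by rewrite -leNgt v_min // inE l'S.
have l_side : 0 < gap s l q'.
  by rewrite -(gap_l' s) -(same_order_below s l_role l'S).
have l_inner : gap s l q' < gap s v q'.
  by rewrite -(same_order_below s (j := Some s) v_role) // gap_l.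
by move: l_inner; rewrite ltNge v_min' // inE lS.
Qed.

Lemma same_trapezoid : through S q = through S q' -> trapezoid S q = trapezoid S q'.
Proof.
move=> eq_thr; have /eqP/cards1P[l thr_q] := q_cut.
have l_role : l \in role S None q by rewrite /= thr_q set11.
have gap_l s : gap s l q = 0 by apply/eqP; rewrite gap_eq0; move: l_role; rewrite inE => /andP[].
have gap_l' s : gap s l q' = 0.
  by apply/eqP; rewrite gap_eq0; move: l_role; rewrite /= eq_thr inE => /andP[].
have eq_side s : side s S q = side s S q'.
  apply/setP => u; rewrite !inE; have [uS|//] := boolP (u \in S).
  by have := same_order s l_role uS; rewrite gap_l gap_l' => ->.
have sub_nearest s : nearest s S q \subset nearest s S q'.
  apply/subsetP => t t_near; have /nearestP[tS t_gt0 t_min] := t_near.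
  have t_side : t \in side s S q' by rewrite -eq_side nearest_side.
  rewrite inE t_side; apply/forall_inP => u; rewrite -eq_side => u_side.
  rewrite leNgt -(same_order_below s (j := Some s) t_near) -?leNgt ?t_min //.
  by move: u_side; rewrite inE => /andP[].
apply/ffunP => s; rewrite !ffunE -eq_side; congr (_, _).
apply/eqP; rewrite eqEcard sub_nearest /=.
have [->|/set0Pn[t /nearest_side]] := eqVneq (nearest s S q') set0; first by rewrite cards0.
rewrite -eq_side => /exists_nearest[t' t'_near].
by rewrite (leq_trans (card_nearest_le1 s S q')) // card_gt0; apply/set0Pn; exists t'.
Qed.

End SameTrapezoid.

Definition role_pairs (S : {set I}) (q : X) : {set option bool * (I * I)} :=
  [set z | (z.2.1 \in role S z.1 q) && (z.2.2 \in S)].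

Definition upcoming (q : X) (z : option bool * (I * I)) : bool :=
  (slope z.2.2 != slope z.2.1) && (px q < crossing z.2.2 z.2.1).

(* A trapezoid cut by the line of [S] through [q] is coded by the first crossing to
   the right of [q] of one of its three lines with another line of [S]; a pair
   [(v, v)] codes the absence of such a crossing. *)
Definition next_crossing (S : {set I}) (q : X) (z : option bool * (I * I)) : bool :=
  [&& z \in role_pairs S q, upcoming q z || (z.2.1 == z.2.2)
    & [forall w in role_pairs S q, upcoming q w ==>
        upcoming q z && (crossing z.2.2 z.2.1 <= crossing w.2.2 w.2.1)]].

Lemma exists_next_crossing S q : #|through S q| = 1%N -> exists z, next_crossing S q z.
Proof.
move=> q_cut; pose coming w := (w \in role_pairs S q) && upcoming q w.
have [/existsP[w0 w0_coming]|/existsPn none] := boolP [exists w, coming w].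
  case: (arg_minP (fun w => crossing w.2.2 w.2.1) w0_coming) => z /andP[z_pair z_up] z_min.
  exists z; rewrite /next_crossing z_pair z_up; apply/forall_inP => w w_pair.
  by apply/implyP => w_up; apply: z_min; rewrite /coming w_pair.
have /card_gt0P[l l_thr] : (0 < #|through S q|)%N by rewrite q_cut.
have l_pair : (None, (l, l)) \in role_pairs S q.
  by rewrite in_set /= l_thr (role_sub (j := None) l_thr).
exists (None, (l, l)); rewrite /next_crossing l_pair eqxx orbT; apply/forall_inP => w w_pair.
by apply/implyP => w_up; have := none w; rewrite /coming w_pair w_up.
Qed.

Lemma next_crossing_trapezoid S q q' z :
  #|through S q| = 1%N -> #|through S q'| = 1%N ->
  next_crossing S q z -> next_crossing S q' z -> trapezoid S q = trapezoid S q'.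
Proof.
wlog qq' : q q' / px q <= px q'.
  move=> wl q_cut q'_cut qz q'z; have [le_qq'|/ltW le_q'q] := leP (px q) (px q').
    exact: wl.
  by apply/esym/wl.
move=> q_cut q'_cut /and3P[z_pair _ /forall_inP z_min] /and3P[z_pair' z_up' _].
have no_crossing j v u : v \in role S j q -> u \in S -> slope u != slope v ->
    px q < crossing u v -> px q' < crossing u v.
  move=> v_role uS slope_uv before; pose w := (j, (v, u)).
  have w_pair : w \in role_pairs S q by rewrite inE v_role.
  have /(implyP (z_min w w_pair))/andP[/andP[slope_z _]] : upcoming q w by apply/andP.
  apply: lt_le_trans; case/orP: z_up' => [/andP[]//|/eqP z_diag].
  by rewrite z_diag eqxx in slope_z.
have keep j v u s : v \in role S j q -> u \in S ->
    gap s v q < gap s u q -> gap s v q' < gap s u q'.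
  move=> v_role uS; rewrite !gap_ltE; case: s => lt_uv;
    apply: height_lt_before_crossing lt_uv qq' _ => slope_uv.
    exact: no_crossing v_role uS slope_uv.
  by rewrite crossingC; apply: no_crossing v_role uS _; rewrite eq_sym.
have same_order j v u s : v \in role S j q -> u \in S ->
    (gap s v q < gap s u q) = (gap s v q' < gap s u q').
  move=> v_role uS; apply/idP/idP; first exact: keep v_role uS.
  have [->|uv] := eqVneq u v; first by rewrite ltxx.
  apply: contraTT; rewrite -leNgt le_eqVlt (negPf (gap_neq _ q_cut uS (role_sub v_role) uv)) /=.
  by rewrite -ltrN2 -!gapN => /(keep _ _ _ _ v_role uS)/ltW; rewrite !gapN lerN2 -leNgt.
move: z_pair z_pair'; rewrite !inE => /andP[v_role _] /andP[v_role' _].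
apply: (same_trapezoid q_cut same_order).
exact: (same_through q_cut q'_cut same_order v_role v_role').
Qed.

Lemma trapezoidD1 S l q : on_line q l -> trapezoid (S :\ l) q = trapezoid S q.
Proof.
move=> ql; have eq_side s : side s (S :\ l) q = side s S q.
  apply/setP => u; rewrite !inE; case: eqVneq => [->|//] /=.
  by move: ql; rewrite -(gap_eq0 s) => /eqP ->; rewrite ltxx andbF.
by apply/ffunP => s; rewrite !ffunE /nearest eq_side.
Qed.

Lemma card_cut_trapezoids_leq S :
  (#|[set trapezoid S q | q in [set q | #|through S q| == 1%N]]| <= 3 * #|S| ^ 2)%N.
Proof.
have -> : (3 * #|S| ^ 2)%N = #|setX [set: option bool] (setX S S)|.
  by rewrite !cardsX cardsT card_option card_bool mulnn.
apply: (leq_card_coded (codes := next_crossing S)) => [q|q q' + + z].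
  rewrite inE => /eqP/exists_next_crossing[z qz]; exists z => //.
  by case/andP: qz; rewrite !inE /= => /andP[/role_sub -> ->].
by rewrite !inE => /eqP q_cut /eqP q'_cut; apply: next_crossing_trapezoid.
Qed.

Lemma sum_met_trapezoids_leq S :
  (\sum_(l in S) #|met_trapezoids (S :\ l) l| <= 3 * #|S| ^ 2)%N.
Proof.
apply: leq_trans (card_cut_trapezoids_leq S); set cut := [set trapezoid S q | q in _].
pose cutter (z : {ffun bool -> {set I} * {set I}}) := S :\: ((z false).1 :|: (z true).1).
have cutterE q : cutter (trapezoid S q) = through S q.
  by rewrite /cutter !ffunE through_sides.
have one_cutter : {in cut, forall z i j, cutter z == [set i] -> cutter z == [set j] -> i = j}.
  by move=> z _ i j /eqP -> /eqP/set1_inj.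
apply: leq_trans (sum_card_labels_leq one_cutter).
rewrite big_mkcond; apply: leq_sum => l _; case: ifP => // lS.
apply/subset_leq_card/subsetP => _ /imsetP[q /[!inE] /andP[ql /eqP free_q] ->].
have thr_q : through S q = [set l].
  apply/setP => u; rewrite !inE; have [->|ul] := eqVneq u l; first by rewrite lS.
  by move/setP/(_ u): free_q; rewrite !inE ul.
rewrite trapezoidD1 // cutterE thr_q eqxx andbT.
by apply: imset_f; rewrite inE thr_q cards1.
Qed.

End GenericArrangement.
End VerticalDecomposition.

(** * A dense group of points *)

Lemma sum_deleted_element (I : finType) (r : nat) (F : {set I} -> I -> nat) :
  (\sum_(S : {set I} | #|S| == r) \sum_(l | l \notin S) F S l =
   \sum_(S : {set I} | #|S| == r.+1) \sum_(l in S) F (S :\ l) l)%N.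
Proof.
rewrite !pair_big_dep /=.
rewrite (reindex_onto (fun z : {set I} * I => (z.1 :\ z.2, z.2))
                      (fun z => (z.2 |: z.1, z.2))) /=; last first.
  by move=> [S l] /andP[_ lS] /=; rewrite setU1K.
apply: eq_bigl => -[S l] /=; rewrite !inE eqxx andbT /=.
have [lS|lNS] := boolP (l \in S).
  by rewrite setD1K // eqxx andbT andbT (cardsD1 l S) lS.
rewrite andbF; apply/negP => /andP[_ /eqP[SE]].
by move: lNS; rewrite -SE setU11.
Qed.

(* Backwards analysis: deleting a random element of a random [(r+1)]-subset yields
   a random [r]-subset together with a random new element. *)
Lemma exists_sample (I : finType) (r K : nat) (F : {set I} -> I -> nat) :
  (r <= #|I|)%N ->
  (forall S : {set I}, #|S| = r.+1 -> (\sum_(l in S) F (S :\ l) l <= K)%N) ->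
  exists2 S : {set I}, #|S| = r &
    (r.+1 * \sum_(l | l \notin S) F S l <= #|I| * K)%N.
Proof.
move=> r_le F_le; pose good (S : {set I}) :=
  (#|S| == r) && (r.+1 * \sum_(l | l \notin S) F S l <= #|I| * K)%N.
have [/existsP[S /andP[/eqP card_S S_good]]|/existsPn no_good] := boolP [exists S, good S].
  by exists S.
have upper : (\sum_(S : {set I} | #|S| == r) \sum_(l | l \notin S) F S l
    <= 'C(#|I|, r.+1) * K)%N.
  rewrite sum_deleted_element -card_draws -sum_nat_const big_mkcond [leqRHS]big_mkcond /=.
  by apply: leq_sum => S _; rewrite inE; case: eqP => // /F_le.
have lower : ('C(#|I|, r) * (#|I| * K).+1 <=
    r.+1 * \sum_(S : {set I} | #|S| == r) \sum_(l | l \notin S) F S l)%N.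
  rewrite -card_draws -sum_nat_const big_distrr big_mkcond [leqRHS]big_mkcond /=.
  apply: leq_sum => S _; rewrite inE; case: ifP => // card_S.
  by have := no_good S; rewrite /good card_S -ltnNge.
have draws_gt0 : (0 < 'C(#|I|, r))%N by rewrite bin_gt0.
have : ('C(#|I|, r) * (#|I| * K).+1 <= (#|I| - r) * 'C(#|I|, r) * K)%N.
  by rewrite -mul_bin_left -mulnA (leq_trans lower) // leq_mul2l upper orbT.
rewrite mulnAC mulnC leq_pmul2r // ltnNge leq_mul2r leq_subr orbT //.
Qed.

Lemma exists_chunks (X : finType) (B : {set X}) (m0 : nat) : (0 < m0)%N ->
  exists h : X -> 'I_#|X|.+1,
    (forall y, (#|B :&: cell h y| <= m0)%N) /\ (m0 * #|h @: B| <= m0 + #|B|)%N.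
Proof.
move=> m0_gt0; pose rank x := index x (enum B).
have rank_lt x : x \in B -> (rank x < #|B|)%N by rewrite cardE index_mem mem_enum.
have chunk_lt x : x \in B -> (rank x %/ m0 < #|X|.+1)%N.
  move=> xB; rewrite ltnS (leq_trans (leq_div _ _)) //.
  by rewrite (leq_trans (ltnW (rank_lt x xB))) ?max_card.
exists (fun x => inord (rank x %/ m0)); split=> [y|].
  rewrite -[leqRHS]card_ord.
  apply: (@leq_card_in _ _ (fun x => Ordinal (ltn_pmod (rank x) m0_gt0))) => x x'.
  rewrite !inE => /andP[xB /eqP xy] /andP[x'B /eqP x'y] /(congr1 val) /= eq_mod.
  have eq_div : (rank x %/ m0 = rank x' %/ m0)%N.
    by have := congr1 val (etrans xy (esym x'y)); rewrite /= !inordK ?chunk_lt.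
  have eq_rank : rank x = rank x'.
    by rewrite (divn_eq (rank x) m0) (divn_eq (rank x') m0) eq_mod eq_div.
  by rewrite -(nth_index x (_ : x \in enum B)) -/(rank x) ?eq_rank ?nth_index ?mem_enum.
have card_chunks : (#|[set (inord (rank x %/ m0) : 'I_#|X|.+1) | x in B]| <= (#|B| %/ m0).+1)%N.
  rewrite -[leqRHS]card_ord -[leqRHS]cardsT.
  apply: leq_trans (leq_imset_card (fun i => inord (val i) : 'I_#|X|.+1) [set: 'I__]).
  apply/subset_leq_card/subsetP => _ /imsetP[x xB ->].
  have chunk_le : (rank x %/ m0 < (#|B| %/ m0).+1)%N by rewrite ltnS leq_div2r // ltnW // rank_lt.
  by apply/imsetP; exists (Ordinal chunk_le).
by rewrite (leq_trans (leq_mul (leqnn m0) card_chunks)) // mulnS leq_add2l mulnC leq_trunc_div.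
Qed.

Lemma exists_class_chunks (X K : finType) (kappa : X -> K) (m0 : nat) : (0 < m0)%N ->
  exists (G : finType) (g : X -> G),
    (forall y, (#|cell g y| <= m0)%N) /\
    forall A : {set X}, (m0 * #|g @: A| <=
      m0 * #|kappa @: A| + #|[set x | kappa x \in kappa @: A]|)%N.
Proof.
move=> m0_gt0.
have /choice[h h_chunks] := fun c => exists_chunks (cell kappa c) m0_gt0.
pose g x := (kappa x, h (kappa x) x); exists (K * 'I_#|X|.+1)%type, g; split=> [[c i]|A].
  apply: leq_trans (proj1 (h_chunks c) i); apply/subset_leq_card/subsetP => x.
  by rewrite !inE xpair_eqE => /andP[/eqP -> ->]; rewrite eqxx.
have g_le : (#|g @: A| <= \sum_(c in kappa @: A) #|h c @: cell kappa c|)%N.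
  rewrite -(sum_card_cells fst) [leqRHS]big_mkcond; apply: leq_sum => c _ /=.
  case: ifPn => [cA|cNA]; last by rewrite setI_cell_notin ?cards0 -?imset_comp.
  apply: leq_trans (leq_imset_card (pair c) (h c @: cell kappa c)).
  apply/subset_leq_card/subsetP => z.
  rewrite in_setI inE => /andP[/imsetP[x xA ->] /eqP /= <-].
  by apply/imset_f/imset_f; rewrite inE.
have classes_le : (\sum_(c in kappa @: A) #|cell kappa c| <= #|[set x | kappa x \in kappa @: A]|)%N.
  rewrite -[leqRHS](sum_card_cells kappa) big_mkcond; apply: leq_sum => c _.
  case: ifP => // cA; apply/subset_leq_card/subsetP => x; rewrite !inE => /eqP ->.
  by rewrite cA eqxx.
apply: leq_trans (leq_mul (leqnn m0) g_le) _.
apply: leq_trans (leq_add (leqnn _) classes_le).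
rewrite big_distrr /= mulnC -sum_nat_const -big_split /=; apply: leq_sum => c _.
exact: (proj2 (h_chunks c)).
Qed.

Lemma sum_card_leq_rich (X I G : finType) (inc : X -> I -> bool) (g : X -> G) (K : nat)
    (D : pred I) (A : I -> {set X}) :
  (forall i, A i \subset points_on inc i) ->
  (\sum_(i | D i) #|A i| <=
     \sum_y rich_incidences inc K (cell g y) + K * \sum_(i | D i) #|g @: A i|)%N.
Proof.
move=> A_sub; pose t i y := #|cell g y :&: points_on inc i|.
pose rich i y := if (K <= t i y)%N then t i y else 0%N.
have A_le i : (#|A i| <= \sum_y rich i y + K * #|g @: A i|)%N.
  rewrite mulnC -sum_nat_const -(sum_card_cells g) [X in (_ + X)%N]big_mkcond -big_split.
  apply: leq_sum => y _; rewrite /rich /=.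
  have [yA|yNA] := boolP (y \in g @: A i); last by rewrite setI_cell_notin ?cards0.
  have sub_line : (#|A i :&: cell g y| <= t i y)%N.
    by rewrite setIC subset_leq_card ?setIS.
  by case: ifPn => [_|]; rewrite -?ltnNge; lia.
apply: leq_trans (leq_sum _ (fun i _ => A_le i)) _.
rewrite big_split /= -big_distrr /= leq_add2r exchange_big /=; apply: leq_sum => y _.
rewrite /rich_incidences [leqRHS]big_mkcond [leqLHS]big_mkcond; apply: leq_sum => i _.
by case: (D i).
Qed.

Lemma exists_cell_above_average (R : realFieldType) (X G : finType) (g : X -> G)
    (J : G -> nat) (Z : R) :
  (forall y, cell g y = set0 -> J y = 0%N) -> 0 < Z -> Z <= (\sum_y J y)%N%:R ->
  exists2 y, cell g y != set0 & Z * #|cell g y|%:R <= #|X|%:R * (J y)%:R.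
Proof.
move=> J0 Z_gt0 Z_le.
pose large y := (cell g y != set0) && (Z * #|cell g y|%:R <= #|X|%:R * (J y)%:R).
have [/existsP[y /andP[y_neq0 y_large]]|/existsPn no_large] := boolP [exists y, large y].
  by exists y.
have [y0 y0_neq0] : exists y, cell g y != set0.
  apply/existsP; apply: contraTT Z_le => /existsPn all0; rewrite -ltNge big1 // => y _.
  by apply/J0/eqP; have := all0 y; rewrite negbK.
have X_gt0 : 0 < #|X|%:R :> R.
  have /set0Pn[x _] := y0_neq0; by rewrite ltr0n; apply/card_gt0P; exists x.
suff : #|X|%:R * (\sum_y J y)%N%:R < Z * #|X|%:R by rewrite mulrC ltr_pM2r // ltNge Z_le.
rewrite -[X in _ < Z * X%:R]cardsT -(sum_card_cells g) !natr_sum !mulr_sumr.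
under [ltRHS]eq_bigr do rewrite setTI.
rewrite [ltLHS](bigID (fun y => cell g y == set0)) [ltRHS](bigID (fun y => cell g y == set0)) /=.
rewrite big1 ?[X in _ < X + _]big1 ?add0r; first last.
- by move=> y /eqP/J0 ->; rewrite mulr0.
- by move=> y /eqP ->; rewrite cards0 mulr0.
apply: ltr_sum => [|y y_neq0]; first by apply/hasP; exists y0; rewrite ?mem_index_enum.
by have := no_large y; rewrite /large y_neq0 -ltNge.
Qed.

Section SampledGroups.
Variables (R : realFieldType) (X I : finType).
Variables (px py : X -> R) (slope icept : I -> R).

Local Notation inc := (on_line px py slope icept).
Local Notation free S l := (free_points px py slope icept S l).

Hypothesis inc_linear : partial_linear inc.
Hypothesis generic : vertically_generic px py slope icept.

Lemma sum_card_points_on_leq_free (S : {set I}) :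
  (\sum_i #|points_on inc i| <= \sum_(i | i \notin S) #|free S i| + #|S| * (#|X| + #|I|))%N.
Proof.
rewrite (bigID (mem S)) /= addnC mulnDr [(#|S| * #|X| + _)%N]addnC addnA.
apply: leq_add; last by rewrite -sum_nat_const; apply: leq_sum => i _; rewrite max_card.
apply: (@leq_trans (\sum_(i | i \notin S) (#|free S i| + #|S|))); last first.
  by rewrite big_split leq_add2l sum_nat_const mulnC leq_mul2l max_card orbT.
apply: leq_sum => i iNS; rewrite -(cardsID (free S i) (points_on inc i)).
apply: leq_add; first by rewrite subset_leq_card ?subsetIr.
pose both (j : {j | j \in S}) := points_on inc i :&: points_on inc (val j).
apply: (@leq_trans #|{: {j | j \in S}}|); last by rewrite card_sig.
apply: (leq_card_cover_le1 (B := both)) => [x|[j jS]].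
  rewrite !inE negb_and => /andP[+ xi]; rewrite xi /= => /set0Pn[j].
  by rewrite inE => /andP[jS xj]; exists (exist _ j jS); rewrite !inE xi.
apply/card_le1_eqP => x y; rewrite !inE /= => /andP[xi xj] /andP[yi yj].
apply/eqP/negPn/negP => yx; case/negP: iNS.
by rewrite (inc_linear yx yi xi yj xj).
Qed.

Lemma exists_sampled_groups (r m0 : nat) : (r <= #|I|)%N -> (0 < m0)%N ->
  exists (S : {set I}) (G : finType) (g : X -> G),
    [/\ #|S| = r, forall y, (#|cell g y| <= m0)%N &
      (r.+1 * (m0 * \sum_(i | i \notin S) #|g @: free S i|)
         <= #|I| * (m0 * (3 * r.+1 ^ 2) + 7 * #|X|))%N].
Proof.
move=> r_le m0_gt0; pose trap := trapezoid px py slope icept.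
pose met := met_trapezoids px py slope icept.
pose F S l := (m0 * #|met S l| + #|[set p | trap S p \in met S l]|)%N.
have [S card_S|S card_S sample_le] := @exists_sample I r (m0 * (3 * r.+1 ^ 2) + 7 * #|X|) F r_le.
  rewrite big_split /= -big_distrr /=; apply: leq_add.
    by rewrite leq_mul2l -card_S sum_met_trapezoids_leq ?orbT.
  under eq_bigr => l _ do rewrite -sum1_card.
  rewrite (exchange_big_dep predT) //= mulnC -sum_nat_const.
  apply: leq_sum => p _; rewrite sum1_card.
  apply: leq_trans (card_lines_meeting_trapezoid_le7 generic S p).
  by apply/subset_leq_card/subsetP => l; rewrite unfold_in !inE.
have [G [g [g_le g_im]]] := exists_class_chunks (trap S) m0_gt0.
exists S, G, g; split=> //; apply: leq_trans sample_le; rewrite leq_mul2l big_distrr.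
by apply: leq_sum => i _; apply: g_im.
Qed.

Definition sampling_loss (x y r m0 K : nat) : R :=
  (r * (x + y))%:R + (K * y)%:R * (3 * r.+1%:R + 7 * x%:R / (r.+1%:R * m0%:R)).

Lemma exists_rich_group (r m0 K : nat) :
  (r <= #|I|)%N -> (0 < m0)%N -> (0 < K)%N ->
  let Z : R := (\sum_i #|points_on inc i|)%N%:R - sampling_loss #|X| #|I| r m0 K in
  0 < Z -> exists A : {set X}, [/\ A != set0, (#|A| <= m0)%N &
    Z * #|A|%:R <= #|X|%:R * (rich_incidences inc K A)%:R].
Proof.
move=> r_le m0_gt0 K_gt0 Z Z_gt0.
have [S [G [g [card_S g_le groups_le]]]] := exists_sampled_groups r_le m0_gt0.
set s := (\sum_(i | i \notin S) #|g @: free S i|)%N in groups_le.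
have s_le : s%:R <= #|I|%:R * (3 * r.+1%:R + 7 * #|X|%:R / (r.+1%:R * m0%:R)) :> R.
  have [r_gt0 m_gt0] : 0 < r.+1%:R :> R /\ 0 < m0%:R :> R by rewrite !ltr0n.
  move: groups_le; rewrite -(ler_nat R) !natrM natrD !natrM.
  move: (r.+1%:R) (m0%:R) r_gt0 m_gt0 => rho mu rho_gt0 mu_gt0 groups_le.
  rewrite -(ler_pM2l (mulr_gt0 rho_gt0 mu_gt0)) -[leLHS]mulrA; apply: le_trans groups_le _.
  by rewrite le_eqVlt; apply/orP; left; apply/eqP; field; rewrite !gt_eqF.
have Z_le : Z <= (\sum_y rich_incidences inc K (cell g y))%N%:R.
  have free_sub i : free S i \subset points_on inc i.
    by apply/subsetP => x; rewrite !inE => /andP[].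
  have := leq_trans (sum_card_points_on_leq_free S)
    (leq_add (sum_card_leq_rich g K (fun i => i \notin S) free_sub) (leqnn _)).
  rewrite -(ler_nat R) !natrD card_S [(K * _)%:R]natrM -/s => total_le.
  have := ler_wpM2l (ler0n R K) s_le; rewrite mulrA -[K%:R * #|I|%:R]natrM.
  by move: total_le; rewrite /Z /sampling_loss; set w := (K * #|I|)%:R * _; lra.
have rich0 y : cell g y = set0 -> rich_incidences inc K (cell g y) = 0%N.
  by move=> y0; rewrite /rich_incidences big1 // => i; rewrite y0 set0I cards0 leqn0 gtn_eqF.
have [y cell_neq0 y_large] := exists_cell_above_average rich0 Z_gt0 Z_le.
by exists (cell g y).
Qed.

End SampledGroups.

Lemma sampling_loss_le (R : realFieldType) (nu delta M : R) (n r m0 K : nat) :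
  nu ^+ 3 = n%:R -> 0 < nu -> 0 < delta -> 0 < M ->
  r%:R <= delta * nu -> delta * nu <= r.+1%:R -> M * nu <= m0%:R ->
  sampling_loss R n n r m0 K <=
    nu ^+ 3 * ((3 * K%:R + 2) * (delta * nu) + 3 * K%:R + 7 * K%:R / (delta * M) * nu).
Proof.
move=> nu3 nu_gt0 delta_gt0 M_gt0 r_le r_ge m0_ge.
have [dnu_gt0 Mnu_gt0] : 0 < delta * nu /\ 0 < M * nu by rewrite !mulr_gt0.
have product_ge : delta * nu * (M * nu) <= r.+1%:R * m0%:R.
  by apply: ler_pM => //; apply: ltW.
have product_gt0 := lt_le_trans (mulr_gt0 dnu_gt0 Mnu_gt0) product_ge.
have crossing_term : K%:R * (7 * nu ^+ 3 / (r.+1%:R * m0%:R)) <= 7 * K%:R / (delta * M) * nu.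
  rewrite [leRHS](_ : _ = K%:R * (7 * nu ^+ 3 / (delta * nu * (M * nu)))).
    rewrite ler_wpM2l // ler_wpM2l ?mulr_ge0 ?exprn_ge0 ?(ltW nu_gt0) //.
    by rewrite lef_pV2 ?posrE ?product_gt0 // mulr_gt0.
  by field; rewrite !gt_eqF.
have line_term : (3 * K%:R + 2) * r%:R <= (3 * K%:R + 2) * (delta * nu).
  by rewrite ler_wpM2l // addr_ge0 // mulr_ge0.
rewrite /sampling_loss !natrM natrD -nu3.
rewrite [leLHS](_ : _ = nu ^+ 3 * ((3 * K%:R + 2) * r%:R + 3 * K%:R
  + K%:R * (7 * nu ^+ 3 / (r.+1%:R * m0%:R)))).
  by rewrite ler_wpM2l ?exprn_ge0 ?(ltW nu_gt0) // lerD // lerD.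
by rewrite -[in 3 * _]natr1; ring.
Qed.

Lemma exists_sampling_parameters (R : archiRealFieldType) (K : nat) (e : R) :
  (0 < K)%N -> 0 < e ->
  exists M nu0 : R, 0 < M /\ forall (nu : R) (n : nat), nu0 <= nu -> nu ^+ 3 = n%:R ->
    exists r m0 : nat, [/\ (r <= n)%N, (0 < m0)%N, m0%:R <= M * nu &
      sampling_loss R n n r m0 K <= e * nu ^+ 4].
Proof.
move=> K_gt0 e_gt0; have K0 : 0 < K%:R :> R by rewrite ltr0n.
pose delta : R := Num.min 1 (e / (3 * (3 * K%:R + 2))).
have delta_gt0 : 0 < delta by rewrite lt_min ltr01 divr_gt0 //; lra.
have delta_le1 : delta <= 1 by rewrite ge_min lexx.
have delta_le : 3 * (3 * K%:R + 2) * delta <= e.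
  by rewrite mulrC -ler_pdivlMr; [rewrite ge_min lexx orbT | lra].
pose M : R := 21 * K%:R / (delta * e).
have M_gt0 : 0 < M by rewrite divr_gt0 // mulr_gt0.
have M_term : 7 * K%:R / (delta * M) = e / 3 by rewrite /M; field; rewrite !gt_eqF.
exists (M + 1), (1 + 9 * K%:R / e); split=> [|nu n nu_ge nu3]; first by lra.
have nu_ge1 : 1 <= nu.
  by apply: le_trans nu_ge; rewrite lerDl divr_ge0 ?mulr_ge0 // ltW.
have nu_gt0 : 0 < nu by lra.
have nu_K : 9 * K%:R <= e * nu by rewrite [leRHS]mulrC -ler_pdivrMr //; lra.
have /andP[r_le r_lt] := truncn_itv (mulr_ge0 (ltW delta_gt0) (ltW nu_gt0)).
have /andP[m_le m_lt] := truncn_itv (mulr_ge0 (ltW M_gt0) (ltW nu_gt0)).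
exists (Num.trunc (delta * nu)), (Num.trunc (M * nu)).+1; split=> //.
- have nu_le_n : nu <= n%:R by rewrite -nu3 exprS ler_peMr ?exprn_ege1 // ltW.
  rewrite -(ler_nat R); apply: le_trans r_le (le_trans _ nu_le_n).
  by rewrite ler_piMl // ltW.
- by rewrite -natr1; lra.
apply: le_trans (sampling_loss_le K nu3 nu_gt0 delta_gt0 M_gt0 r_le (ltW r_lt) (ltW m_lt)) _.
rewrite M_term [in leRHS]exprSr [leRHS]mulrCA ler_pM2l ?exprn_gt0 //.
by have := ler_wpM2r (ltW nu_gt0) delta_le; lra.
Qed.

Lemma incidences_general_clique (R : archiRealFieldType) (k : nat) (c : R) :
  (0 < k)%N -> 0 < c ->
  exists nu0 : R, forall (X I : finType) (px py : X -> R) (slope icept : I -> R) (nu : R),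
    let inc := on_line px py slope icept in
    partial_linear inc -> vertically_generic px py slope icept ->
    nu0 <= nu -> nu ^+ 3 = #|X|%:R -> #|I| = #|X| ->
    c * nu ^+ 4 <= (\sum_i #|points_on inc i|)%N%:R ->
    exists2 W, size W = k & general_clique inc W.
Proof.
move=> k_gt0 c_gt0; have c2_gt0 : 0 < c / 2 by rewrite divr_gt0.
have K_gt1 : (1 < 2 * k)%N by rewrite (leq_trans _ (leq_pmulr 2 k_gt0)).
have [M [nu1 [M_gt0 params]]] := exists_sampling_parameters (ltnW K_gt1) c2_gt0.
have c1_gt0 : 0 < c / 2 / M by rewrite divr_gt0.
have [m1 dense_clique] := dense_subset_general_clique k_gt0 c1_gt0.
exists (Num.max nu1 (4 * m1%:R / c + 1)) => X I px py slope icept nu inc inc_linear generic.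
rewrite ge_max => /andP[nu_ge nu_m1] nu3 card_I incidences_ge.
have nu_gt0 : 0 < nu.
  by apply: lt_le_trans nu_m1; rewrite ltr_wpDl // divr_ge0 ?mulr_ge0 // ltW.
have [r [m0 [r_le m0_gt0 m0_le loss_le]]] := params nu #|X| nu_ge nu3.
rewrite -card_I in r_le.
have nu3_gt0 : 0 < nu ^+ 3 by rewrite exprn_gt0.
have nu4E : nu ^+ 4 = nu ^+ 3 * nu by rewrite exprSr.
have [|A [A_neq0 A_le A_rich]] := exists_rich_group inc_linear generic r_le m0_gt0 (ltnW K_gt1).
  by have : 0 < c / 2 * nu ^+ 4; [rewrite mulr_gt0 ?exprn_gt0 | rewrite card_I; lra].
have A_gt0 : 0 < #|A|%:R :> R by rewrite ltr0n card_gt0.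
have {}A_rich : c / 2 * nu * #|A|%:R <= (rich_incidences inc (2 * k) A)%:R.
  rewrite -(ler_pM2l nu3_gt0) [in leRHS]nu3; apply: le_trans A_rich.
  by rewrite card_I mulrA ler_pM2r // mulrCA -nu4E; lra.
have rich_le := rich_incidences_leq inc_linear A K_gt1.
apply: dense_clique inc_linear _ _.
- move: rich_le; rewrite -(ler_nat R) natrM natrX expr2 => /(le_trans A_rich).
  rewrite mulrA ler_pM2r // => A_large; rewrite -(ler_nat R).
  by move: nu_m1; rewrite -lerBrDr ler_pdivrMr //; lra.
- apply: le_trans A_rich; rewrite expr2 mulrA ler_pM2r //.
  rewrite mulrAC ler_pdivrMr // -[leRHS]mulrA ler_pM2l // [leRHS]mulrC.
  by apply: le_trans m0_le; rewrite ler_nat.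
Qed.

(** * Lines in the plane *)

Lemma exists_unsolvable_slope (R : realFieldType) (s : seq (R * R)) :
  exists t, {in s, forall z, t * z.1 = z.2 -> z.1 = 0}.
Proof.
exists (\big[Num.max/0]_(z <- s) (z.2 / z.1) + 1) => z zs; set m := \big[_/_]_(_ <- _) _.
move=> slopeE; apply/eqP/negPn/negP => z1_neq0.
have : z.2 / z.1 <= m := @le_bigmax_seq _ R _ s 0 z xpredT (fun z => z.2 / z.1) zs isT.
by rewrite -slopeE mulfK // leNgt ltrDl ltr01.
Qed.

Section GenericShear.
Variables (R : realFieldType) (X I : finType) (pt : X -> R * R) (A B C : I -> R).

Definition residual (i : I) (q : R * R) : R := A i * q.1 + B i * q.2 - C i.

Hypothesis normal_neq0 : forall i, (A i, B i) <> (0, 0).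
Hypothesis line_inj : forall i j,
  (forall q, (residual i q == 0) = (residual j q == 0)) -> i = j.

Lemma proportional_residuals i j q : i != j ->
  residual i q * A j = residual j q * A i -> residual i q * B j = residual j q * B i ->
  residual i q = 0.
Proof.
move=> ij eqA eqB; apply/eqP/negPn/negP => res_i.
have res_j : residual j q != 0.
  apply/eqP => res_j; apply: (normal_neq0 (i := j)).
  move: eqA eqB => /eqP + /eqP.
  by rewrite res_j !mul0r !mulf_eq0 (negPf res_i) /= => /eqP -> /eqP ->.
move/eqP: ij; apply; apply: line_inj => r.
have prop : residual i q * residual j r = residual j q * residual i r.
  have expand k : residual k r = residual k q + A k * (r.1 - q.1) + B k * (r.2 - q.2).
    by rewrite /residual; ring.
  rewrite (expand j) (expand i); move: (residual i q) (residual j q) eqA eqB => e e' eqA eqB.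
  by rewrite !mulrDr ![e * (_ * _)]mulrA eqA eqB; ring.
by rewrite -[LHS](mulrI_eq0 _ (mulfI res_j)) -prop (mulrI_eq0 _ (mulfI res_i)).
Qed.

(* After the shear [(u, v) |-> (u + t * v, v)], the height of line [i] above a point [q]
   is [q.2 - residual i q / (B i - t * A i)]. *)
Lemma exists_generic_shear : exists t : R,
  (forall i, B i - t * A i != 0) /\
  (forall i j x, i != j -> residual i (pt x) * (B j - t * A j)
     = residual j (pt x) * (B i - t * A i) -> residual i (pt x) = 0).
Proof.
pose e i x := residual i (pt x).
have [t t_generic] := exists_unsolvable_slope ([seq (A i, B i) | i <- enum I] ++
  [seq (e z.1.1 z.2 * A z.1.2 - e z.1.2 z.2 * A z.1.1,
        e z.1.1 z.2 * B z.1.2 - e z.1.2 z.2 * B z.1.1) | z <- enum {: I * I * X}]).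
exists t; split=> [i|i j x ij cross].
  apply/eqP => /eqP; rewrite subr_eq0 => /eqP slopeE; apply: (normal_neq0 (i := i)).
  have A0 : A i = 0.
    by apply: (t_generic (A i, B i)) => //; rewrite mem_cat map_f // mem_enum.
  by rewrite slopeE A0 mulr0.
pose z := (e i x * A j - e j x * A i, e i x * B j - e j x * B i).
have slopeE : t * z.1 = z.2 by move: cross; rewrite /z /e /=; lra.
have z_in : z \in [seq (e z.1.1 z.2 * A z.1.2 - e z.1.2 z.2 * A z.1.1,
    e z.1.1 z.2 * B z.1.2 - e z.1.2 z.2 * B z.1.1) | z <- enum {: I * I * X}].
  by apply/mapP; exists (i, j, x); rewrite ?mem_enum.
have z1 : z.1 = 0 by apply: t_generic slopeE; rewrite mem_cat z_in orbT.
have z2 : z.2 = 0 by rewrite -slopeE z1 mulr0.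
by apply: proportional_residuals ij _ _; apply/eqP; rewrite -subr_eq0; apply/eqP.
Qed.

Lemma exists_generic_coordinates :
  exists (px py : X -> R) (slope icept : I -> R),
    (forall x i, on_line px py slope icept x i = (residual i (pt x) == 0)) /\
    vertically_generic px py slope icept.
Proof.
have [t [pivot_neq0 t_generic]] := exists_generic_shear.
pose d i := B i - t * A i.
pose px x := (pt x).1 + t * (pt x).2; pose py x := (pt x).2.
pose slope i := - A i / d i; pose icept i := C i / d i.
have heightE i x : height slope icept i (px x) = py x - residual i (pt x) / d i.
  rewrite /height /slope /icept /px /py /residual /d.
  by field; exact: pivot_neq0.
have on_lineE x i : on_line px py slope icept x i = (residual i (pt x) == 0).
  rewrite /on_line heightE -subr_eq0 opprD addNKr opprK mulf_eq0 invr_eq0.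
  by rewrite (negPf (pivot_neq0 i)) orbF.
exists px, py, slope, icept; split=> // x i j ij.
rewrite !heightE on_lineE => /addrI/oppr_inj/eqP; rewrite eqr_div ?pivot_neq0 // => /eqP.
by move=> /(t_generic i j x ij) ->.
Qed.

End GenericShear.

Local Open Scope classical_set_scope.
Local Open Scope fset_scope.
Local Open Scope ring_scope.

Lemma is_line_memE (R : realType) (l : set (R * R)) (p q r : R * R) :
  is_line l -> p <> q -> l p -> l q ->
  l r <-> (r.1 - p.1) * (q.2 - p.2) = (r.2 - p.2) * (q.1 - p.1).
Proof.
move=> [a [b [c [ab ->]]]] pq /= lp lq; set u1 := q.1 - p.1; set u2 := q.2 - p.2.
set v1 := r.1 - p.1; set v2 := r.2 - p.2.
have au : a * u1 + b * u2 = 0 by rewrite /u1 /u2; lra.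
have -> : (a * r.1 + b * r.2 = c) <-> (a * v1 + b * v2 = 0).
  by rewrite /v1 /v2; split; lra.
split=> [av|det0]; first apply/eqP; last apply/eqP.
- rewrite -subr_eq0; apply: contra_notT ab => det.
  have a0 : a * (v1 * u2 - v2 * u1) = (a * v1 + b * v2) * u2 - (a * u1 + b * u2) * v2 by ring.
  have b0 : b * (v1 * u2 - v2 * u1) = (a * u1 + b * u2) * v1 - (a * v1 + b * v2) * u1 by ring.
  move: a0 b0; rewrite au av !mul0r subrr => /eqP + /eqP.
  by rewrite !mulf_eq0 (negPf det) !orbF => /eqP -> /eqP ->.
- apply: contra_notT pq => av.
  have u1_0 : u1 * (a * v1 + b * v2) = (a * u1 + b * u2) * v1 + b * (v2 * u1 - v1 * u2) by ring.
  have u2_0 : u2 * (a * v1 + b * v2) = (a * u1 + b * u2) * v2 + a * (v1 * u2 - v2 * u1) by ring.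
  move: u1_0 u2_0; rewrite au det0 subrr !mul0r !mulr0 addr0 => /eqP + /eqP.
  rewrite !mulf_eq0 (negPf av) !orbF !subr_eq0.
  by case: p q {lp lq u1 u2 v1 v2 au det0 av} => [? ?] [? ?] /= /eqP -> /eqP ->.
Qed.

Lemma is_line_unique (R : realType) (l l' : set (R * R)) (p q : R * R) :
  is_line l -> is_line l' -> p <> q -> l p -> l q -> l' p -> l' q -> l = l'.
Proof.
move=> l_line l'_line pq lp lq lp' lq'; apply/seteqP.
have memE := is_line_memE _ l_line pq lp lq; have memE' := is_line_memE _ l'_line pq lp' lq'.
by split=> r; [move/memE/memE' | move/memE'/memE].
Qed.

Definition incident (R : realType) (X I : Type) (pt : X -> R * R) (ln : I -> set (R * R))
    (x : X) (i : I) : bool := pt x \in ln i.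

Lemma lines_partial_linear (R : realType) (X I : finType)
    (pt : X -> R * R) (ln : I -> set (R * R)) :
  injective pt -> injective ln -> (forall i, is_line (ln i)) ->
  partial_linear (incident pt ln).
Proof.
move=> pt_inj ln_inj ln_line x y i j xy; rewrite /incident !in_setE => xi yi xj yj.
apply: ln_inj; apply: (@is_line_unique _ _ _ (pt x) (pt y)) => // /pt_inj.
exact/eqP.
Qed.

Lemma lines_generic_coordinates (R : realType) (X I : finType)
    (pt : X -> R * R) (ln : I -> set (R * R)) :
  injective ln -> (forall i, is_line (ln i)) ->
  exists (px py : X -> R) (slope icept : I -> R),
    on_line px py slope icept = incident pt ln /\ vertically_generic px py slope icept.
Proof.
move=> ln_inj ln_line.
have /choice[coef coefP] : forall i, exists z : R * R * R, (z.1.1, z.1.2) <> (0, 0) /\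
    ln i = [set p : R * R | z.1.1 * p.1 + z.1.2 * p.2 = z.2]%classic.
  by move=> i; have [a [b [c [ab lnE]]]] := ln_line i; exists (a, b, c).
pose A i := (coef i).1.1; pose B i := (coef i).1.2; pose C i := (coef i).2.
have residualE i q : (residual A B C i q == 0) = (q \in ln i).
  have [_ ->] := coefP i; rewrite /residual subr_eq0.
  by apply/eqP/idP => [eq_q|]; rewrite in_setE.
have [|i j same_line|px [py [slope [icept [on_lineE generic]]]]] :=
  @exists_generic_coordinates R X I pt A B C.
- by move=> i; have [] := coefP i.
- apply: ln_inj; apply/seteqP; split=> q /mem_set.
    by rewrite -residualE same_line residualE => /set_mem.
  by rewrite -residualE -same_line residualE => /set_mem.
exists px, py, slope, icept; split=> //.
by apply/funext => x; apply/funext => i; rewrite on_lineE residualE.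
Qed.

Lemma lines_general_clique (R : realType) (k : nat) (c : R) : 0 < c ->
  exists n0 : nat, forall (X I : finType) (pt : X -> R * R) (ln : I -> set (R * R)),
    injective pt -> injective ln -> (forall i, is_line (ln i)) ->
    (n0 <= #|X|)%N -> #|I| = #|X| ->
    c * #|X|%:R `^ (4 / 3) <= (\sum_i #|points_on (incident pt ln) i|)%N%:R ->
    exists2 W, size W = k & general_clique (incident pt ln) W.
Proof.
move=> c_gt0; have [->|k_gt0] := posnP k.
  by exists 0%N => X I pt ln *; exists [::].
have [nu0 clique] := incidences_general_clique k_gt0 c_gt0.
exists (Num.bound (Num.max nu0 1 ^+ 3)) => X I pt ln pt_inj ln_inj ln_line X_large card_I.
pose nu : R := #|X|%:R `^ (1 / 3).
have nuX m : nu ^+ m = #|X|%:R `^ (m%:R / 3).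
  by rewrite -powR_mulrn ?powR_ge0 // -powRrM mulrC mulrA mulr1.
have nu3 : nu ^+ 3 = #|X|%:R by rewrite nuX divff ?powRr1 // pnatr_eq0.
rewrite -nuX => incidences_ge.
have nu_large : nu0 <= nu.
  apply: (@le_trans _ _ (Num.max nu0 1)); first by rewrite le_max lexx.
  have max_ge0 : 0 <= Num.max nu0 1 by rewrite le_max ler01 orbT.
  rewrite -(@ler_pXn2r _ 3) ?nnegrE ?powR_ge0 // nu3.
  by apply: le_trans (ltW (archi_boundP _)) _; rewrite ?exprn_ge0 // ler_nat.
have inc_linear := lines_partial_linear pt_inj ln_inj ln_line.
have [px [py [slope [icept [on_lineE generic]]]]] := lines_generic_coordinates pt ln_inj ln_line.
rewrite -on_lineE in inc_linear incidences_ge *.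
exact: clique inc_linear generic nu_large nu3 card_I incidences_ge.
Qed.

Lemma card_incidences_leq (R : realType) (P : {fset R * R}) (L : {fset set (R * R)}) :
  (#|` incidences P L| <= \sum_(l : L) #|points_on (incident (@fsval _ P) (@fsval _ L)) l|)%N.
Proof.
set inc := incident _ _; pose flags := [set z : P * L | inc z.1 z.2]%SET.
have flags_on l : flags :&: cell snd l = pair^~ l @: points_on inc l.
  apply/setP => -[p l']; rewrite !inE /=; apply/andP/imsetP => [[pl /eqP <-]|[p' p'l [-> ->]]].
    by exists p; rewrite ?inE.
  by split; rewrite // -in_points_on.
have -> : (\sum_(l : L) #|points_on inc l| = #|flags|)%N.
  rewrite -(sum_card_cells snd); apply: eq_bigr => l _.
  by rewrite flags_on card_imset // => p q [].
have inP (z : incidences P L) : (fsval z).1 \in P.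
  by have := fsvalP z; rewrite !inE => /andP[/andP[]].
have inL (z : incidences P L) : (fsval z).2 \in L.
  by have := fsvalP z; rewrite !inE => /andP[/andP[]].
pose flag (z : incidences P L) : P * L := ([` inP z], [` inL z])%fset.
have flag_inj : injective flag.
  move=> z z' [eq1 eq2]; apply: val_inj => /=.
  by case: (fsval z) (fsval z') eq1 eq2 => [? ?] [? ?] /= -> ->.
rewrite cardfE -(card_codom flag_inj); apply/subset_leq_card/subsetP => _ /codomP[z ->].
by rewrite inE /=; have := fsvalP z; rewrite !inE => /andP[].
Qed.

Lemma general_clique_position (R : realType) (P : {fset R * R}) (L : {fset set (R * R)})
    (W : seq P) :
  {in L, forall l, is_line l} -> general_clique (incident (@fsval _ P) (@fsval _ L)) W ->
  general_position [fset x in map (@fsval _ P) W]%fset.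
Proof.
move=> L_line [_ W_joined W_general] p q r.
rewrite !inE => /mapP[p' p'W ->] /mapP[q' q'W ->] /mapP[r' r'W ->] pq pr qr.
move=> [l l_line [lp lq lr]].
have neq (x y : P) : fsval x <> fsval y -> x != y.
  by move=> xy; apply/eqP => eq_xy; rewrite eq_xy in xy.
have /andP[_ /existsP[i /andP[pi qi]]] := W_joined p' q' p'W q'W (neq _ _ pq).
have lE : l = fsval i.
  by apply: (is_line_unique l_line (L_line _ (fsvalP i)) pq lp lq); rewrite -in_setE.
case/negP: (W_general p' q' r' p'W q'W r'W (neq _ _ pq) (neq _ _ pr) (neq _ _ qr)).
by apply/existsP; exists i; rewrite pi qi /incident -lE in_setE.
Qed.

Theorem theorem1 (R : realType) (k : nat) (c : R) (c_gt0 : 0 < c) :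
  exists n0 : nat, forall (n : nat) (L : {fset set (R * R)}) (P : {fset R * R}),
    (n0 <= n)%N ->
    (forall l : set (R * R), l \in L -> is_line l) ->
    #|` L| = n ->
    #|` P| = n ->
    c * n%:R `^ (4 / 3) <= #|` incidences P L|%:R ->
    exists S : {fset R * R},
      [/\ (S `<=` P)%fset, #|` S| = k, general_position S &
          forall p q : R * R, p \in S -> q \in S -> p <> q ->
            exists2 l : set (R * R), l \in L & p \in l /\ q \in l].
Proof.
have [n0 clique] := lines_general_clique k c_gt0.
exists n0 => n L P n_ge L_line card_L card_P incidences_ge.
rewrite cardfE in card_L; rewrite cardfE in card_P.
have [||||W size_W W_clique] := clique P L (@fsval _ P) (@fsval _ L) val_inj val_inj.
- by move=> l; apply: L_line (fsvalP l).
- by rewrite card_P.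
- by rewrite card_L.
- by rewrite card_P (le_trans incidences_ge) // ler_nat card_incidences_leq.
exists [fset x in map (@fsval _ P) W]%fset; have [W_uniq W_joined _] := W_clique; split.
- by apply/fsubsetP => x; rewrite inE => /mapP[p _ ->]; apply: fsvalP.
- by rewrite card_fseq undup_id ?size_map // map_inj_uniq //; apply: val_inj.
- exact: general_clique_position L_line W_clique.
move=> _ _ /[!inE] /mapP[p pW ->] /mapP[q qW ->] pq.
have pq' : p != q by apply/eqP => eq_pq; rewrite eq_pq in pq.
have /andP[_ /existsP[l /andP[pl ql]]] := W_joined p q pW qW pq'.
by exists (fsval l); first exact: fsvalP.
Qed.
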